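(* Let $n \ge 2$ and let $\{X_t\}_{t\ge 0}$ be Kac's walk on $\mathrm{S}^{n-1}$, and let $\mu$ be the normalized Haar (uniform) probability measure on $\mathrm{S}^{n-1}$. (i) Fix $C_1 < \frac{1}{2}$. If a sequence of times $\{T_1(n)\}_{n \in \mathbb{N}}$ satisfies $T_1(n) < C_1 n \log(n)$ for all $n$, then $$\lim_{n\to\infty} \inf_{X_0 \in \mathrm{S}^{n-1}} \| \mathcal{L}(X_{T_1(n)}) - \mu \|_{\mathrm{TV}} = 1.$$ (ii) Fix $C_2 > 200$. If a sequence of times $\{T_2(n)\}_{n \in \mathbb{N}}$ satisfies $T_2(n) > C_2 n \log(n)$ for all $n$, then $$\lim_{n\to\infty} \sup_{X_0 \in \mathrm{S}^{n-1}} \| \mathcal{L}(X_{T_2(n)}) - \mu \|_{\mathrm{TV}} = 0.$$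
   Context: $\mathrm{S}^{n-1} = \{X \in \mathbb{R}^n : \sum_{i=1}^n X[i]^2 = 1\}$. Kac's walk on $\mathrm{S}^{n-1}$ is the discrete-time Markov chain $\{X_t\}_{t \ge 0}$ on $\mathrm{S}^{n-1}$ evolving as follows: at each step $t$, independently of the past, choose a pair of indices $1 \le i_t < j_t \le n$ uniformly at random among all such pairs and an angle $\theta_t \in [0,2\pi)$ uniformly at random, and set $X_{t+1}[i_t] = \cos(\theta_t) X_t[i_t] - \sin(\theta_t) X_t[j_t]$, $X_{t+1}[j_t] = \sin(\theta_t) X_t[i_t] + \cos(\theta_t) X_t[j_t]$, and $X_{t+1}[k] = X_t[k]$ for $k \notin \{i_t, j_t\}$. $\mathcal{L}(Z)$ denotes the law of a random variable $Z$, and for probability measures $\nu_1,\nu_2$ on the same measurable space, $\|\nu_1 - \nu_2\|_{\mathrm{TV}} = \sup_A (\nu_1(A) - \nu_2(A))$. The walk is started deterministically at $X_0$. *)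

(* Defs.v *)
From HB Require Import structures.
From mathcomp Require Import all_boot all_order all_algebra.
From mathcomp Require Import all_classical all_reals all_analysis.
Set Implicit Arguments. Unset Strict Implicit. Unset Printing Implicit Defensive.
Import Order.TTheory GRing.Theory Num.Theory.
Import numFieldNormedType.Exports.
Local Open Scope classical_set_scope.
Local Open Scope ring_scope.

Definition Rn (R : realType) (n : nat) : measurableType _ :=
  g_sigma_algebraType (@open 'rV[R]_n).

Definition sphere (R : realType) (n : nat) : set (Rn R n) :=
  [set x : 'rV[R]_n | \sum_(i < n) (x ord0 i) ^+ 2 = 1].
Arguments sphere : clear implicits.

Definition kac_rot (R : realType) (n : nat) (i j : 'I_n) (th : R)
    (x : Rn R n) : Rn R n :=
  \row_(k < n) (if k == i then cos th * x ord0 i - sin th * x ord0 j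
                else if k == j then sin th * x ord0 i + cos th * x ord0 j
                else x ord0 k).

(* kac_law t x A = P(X_t \in A | X_0 = x): the chain after t steps, where at
   each step the pair i<j is uniform among the 'C(n,2) pairs and the angle is
   uniform on [0, 2 pi), independently of the past.  Written as the iterated
   expectation over the first step (Markov property / Fubini). *)
Fixpoint kac_law (R : realType) (n : nat) (t : nat) (x : Rn R n)
    (A : set (Rn R n)) : \bar R :=
  match t with
  | 0 => ((\1_A x : R)%:E)
  | t'.+1 =>
      ((('C(n, 2))%:R : R)^-1)%:E *
      (\sum_(i < n) \sum_(j < n | (i < j)%N)
         (((2 * pi : R)^-1)%:E *
          \int[@lebesgue_measure R]_(th in `[0%R, (2 * pi)%R[)
             kac_law t' (kac_rot i j th x) A))%E
  end%E.

Definition tv_dist (R : realType) (n : nat)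
    (nu1 nu2 : set (Rn R n) -> \bar R) : \bar R :=
  ereal_sup [set (nu1 A - nu2 A)%E | A in [set A : set (Rn R n) | measurable A]].

Definition orthogonal_mx (R : realType) (n : nat) (Q : 'M[R]_n) : Prop :=
  Q *m Q^T = 1%:M.

Definition is_uniform_sphere (R : realType) (n : nat)
    (mu : probability (Rn R n) R) : Prop :=
  mu (sphere R n) = 1%E /\
  forall Q : 'M[R]_n, orthogonal_mx Q ->
    forall A : set (Rn R n), measurable A ->
      mu [set x : Rn R n | A (x *m Q)] = mu A.

(* Main.v *)
(* (i) A coordinate that no step has touched keeps its initial value, while under
   the uniform law the set of points agreeing with X_0 in some coordinate is null.
   The coupon-collector second moment method shows that before n log n / 2 steps
   some coordinate is untouched with high probability.

   (ii) Both stages compare the chain from x with the chain from a point y, which is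
   finally averaged over the stationary law.
   First stage: using the same pairs and the same polar angle in the chosen plane,
   the mean of sum_k (x_k^2 - y_k^2)^2 shrinks by the factor 1 - 1/(2n) per step.
   Second stage: the pairs e_1, ..., e_t are fixed in advance, and as soon as they
   connect all the coordinates the two chains can be made to meet.  Call blocks the
   connected components of the graph of the steps still to come; the coupling keeps
   the sum of x_k^2 - y_k^2 equal to zero on every block.  Only a step whose removal
   splits its block constrains the angles: it asks for cos 2 psi = al cos 2 phi + be
   with al near 1 and be near 0, and such a map nearly preserves the uniform angle,
   unless the rotated pair of y is very small.  When no step is left the blocks are
   singletons, so the squares agree, and the signs have been matched on the way. *)

Require Import Defs.
From HB Require Import structures.
From mathcomp Require Import all_boot all_order all_algebra.
From mathcomp Require Import all_classical all_reals all_analysis.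
From mathcomp Require Import measurable_realfun ring lra.
Import Order.TTheory GRing.Theory Num.Theory.
Import numFieldNormedType.Exports.
Set Implicit Arguments. Unset Strict Implicit. Unset Printing Implicit Defensive.
Local Open Scope classical_set_scope.
Local Open Scope ring_scope.

(** * Couplings of a uniform angle *)

(** No joint law of two chains is ever built. Every comparison is an inequality between Markov
    operators applied to a test function f with values in [0,1], of the form P f(x) <= P f(y) +
    error(y), and a coupling of angles becomes a one-sided change of variables under an integral.
    The error depends on y alone, so integrating y over the stationary law turns each of its terms
    into the stationary probability of a small pair, whatever step it comes from. The obstacle is
    that contraction only brings the chains close, while total variation needs them to coincide. A
    coupling that discovers the pairs one by one cannot know which squares will get another chance
    to be corrected; knowing all the pairs tells at each step which sums have to vanish from then
    on. Averaging over the lists of pairs gives back the walk. The l1 bound [D] does not grow along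
    the second stage, so polynomial closeness suffices at its start. The first stage, about 197 n
    log n steps at rate 1/(2n), yields n^-98, where a little more than n^-60 would do: the constant
    200 leaves much room. *)

Section expanding.
Context {R : realType}.
Local Notation leb := (@lebesgue_measure R).
Local Open Scope ereal_scope.

(** [S] lies in the closed interval of length [d] that starts at [inf S]. The maximum with 0 serves
    the empty [S], for which [d] may be negative. *)
Lemma lebesgue_measure_diam (S : set R) (d : R) : measurable S ->
  (forall x y, S x -> S y -> (y - x <= d)%R) -> leb S <= (Num.max 0 d)%:E.
Proof.
move=> mS Sd; have [->|/set0P[x0 Sx0]] := eqVneq S set0.
  by rewrite measure0 lee_fin le_max lexx.
have d0 : (0 <= d)%R by have := Sd _ _ Sx0 Sx0; rewrite subrr.
have lbS : has_inf S.
  by split; [exists x0|exists (x0 - d)%R => y /Sd /(_ Sx0); lra].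
have sub : S `<=` `[inf S, (inf S + d)%R]%classic.
  move=> y Sy; rewrite /= in_itv /= ge_inf //=; last by case: lbS.
  rewrite -lerBlDr; apply: lb_le_inf; first by exists x0.
  by move=> z Sz; have := Sd _ _ Sz Sy; lra.
apply: (@le_trans _ _ (leb `[inf S, (inf S + d)%R])).
  by apply: le_measure => //; rewrite inE //; exact: measurable_itv.
rewrite lebesgue_measure_itv /= lte_fin; case: ifP => _.
  by rewrite -EFinB lee_fin addrAC subrr add0r le_max lexx orbT.
by rewrite lee_fin le_max lexx.
Qed.

Variables (D : set R) (L : R) (tau : R -> R).
Hypothesis mD : measurable D.
Hypothesis L0 : (0 < L)%R.
Hypothesis mtau : measurable_fun setT tau.
Hypothesis expand : forall x y, D x -> D y ->
  (`|x - y| <= L * `|tau x - tau y|)%R.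

(** The preimage of a half-open interval has diameter at most [L] times its length; the general case
    follows because Lebesgue measure is an infimum over countable covers by such intervals. *)
Lemma preimage_expanding (B : set R) : measurable B ->
  leb (D `&` tau @^-1` B) <= L%:E * leb B.
Proof.
move=> mB.
have mpre (C : set R) : measurable C -> measurable (D `&` tau @^-1` C).
  by move=> mC; apply: measurableI => //; rewrite -[_ @^-1` _]setTI; exact: mtau.
have itvle (F : set R) : ocitv F ->
    leb (D `&` tau @^-1` F) <= L%:E * wlength idfun F.
  move=> /ocitvP[->|[[a b] /= ab ->]].
    by rewrite preimage_set0 setI0 measure0 wlength0 mule0.
  rewrite wlength_itv /= lte_fin ab -EFinB -EFinM.
  have Lab : (0 <= L * (b - a))%R by rewrite mulr_ge0 ?subr_ge0 ?ltW.
  rewrite -[leRHS](_ : (Num.max 0 (L * (b - a)))%:E = _); last first.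
    by rewrite max_r.
  apply: lebesgue_measure_diam; first by apply: mpre; exact: measurable_itv.
  move=> x y [Dx /=]; rewrite in_itv /= => /andP[ax xb] [Dy /=].
  rewrite in_itv /= => /andP[ay yb].
  apply: le_trans (ler_norm _) _; apply: le_trans (expand Dy Dx) _.
  by rewrite ler_pM2l // ler_norml; apply/andP; split; lra.
rewrite -lee_pdivrMl //.
apply: le_ereal_inf_tmp => _ [F [mF BF] <-].
rewrite lee_pdivrMl // -nneseriesZl; last by move=> i _; exact: wlength_ge0.
apply: (@le_trans _ _ (\sum_(0 <= i <oo) leb (D `&` tau @^-1` F i))).
  apply: le_trans (outer_measure_sigma_subadditive _ _).
  apply: le_measure; rewrite ?inE; first exact: mpre.
    apply: bigcup_measurable => k _; apply: mpre.
    by apply: sub_sigma_algebra; exact: mF.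
  move=> x [Dx /BF[k _ Fk]]; exists k => //.
by apply: lee_nneseries => // i _; apply: itvle; exact: mF.
Qed.

(** A one-sided change of variables: by [preimage_expanding], the image under [tau] of Lebesgue
    measure on [D] is at most [L] times Lebesgue measure. *)
Lemma ge0_integral_expanding (E : set R) (f : R -> \bar R) : measurable E ->
  measurable_fun setT f -> (forall x, 0 <= f x) ->
  (forall x, D x -> E (tau x)) ->
  \int[leb]_(x in D) f (tau x) <= L%:E * \int[leb]_(x in E) f x.
Proof.
move=> mE mf f0 DE.
pose m1 : {measure set (measurableTypeR R) -> \bar R} := mrestr leb mD.
have Lge0 := ltW L0.
pose m2 : {measure set (measurableTypeR R) -> \bar R} := mscale (NngNum Lge0) leb.
have mpre : measurable (tau @^-1` E).
  by rewrite -[_ @^-1` _]setTI; exact: mtau.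
have mft : measurable_fun setT (f \o tau) by exact: measurableT_comp.
have -> : \int[leb]_(x in D) f (tau x) = \int[m1]_(x in tau @^-1` E) f (tau x).
  rewrite -(setDUK (A := D) (B := tau @^-1` E)) //.
  rewrite ge0_integral_setU //=; last 3 first.
  - exact: measurableD.
  - exact: measurable_funTS.
  - by rewrite disj_set2E setDIK.
  rewrite [X in _ + X]null_set_integral ?adde0.
  - by apply: eq_measure_integral => A mA AD; rewrite /m1 /= /mrestr setIidl.
  - exact: measurableD.
  - exact: measurable_funTS.
  - by rewrite /m1 /= /mrestr setIC setDIK measure0.
rewrite -(@ge0_integral_mscale _ _ _ leb E mE (NngNum Lge0)) //; last 1 first.
  exact: measurable_funTS.
have mtau' : @measurable_fun _ _ (measurableTypeR R) (measurableTypeR R) setT tau.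
  exact: mtau.
rewrite -[leLHS](@ge0_integral_pushforward _ _ _ _ _ _ mtau' m1 E f mE) //; last first.
  exact: measurable_funTS.
apply: ge0_le_measure_integral => // S mS.
change (leb (tau @^-1` S `&` D) <= L%:E * leb S); rewrite setIC.
exact: preimage_expanding.
Qed.

End expanding.

(** * Elementary trigonometric bounds *)

Section trig.
Context {R : realType}.
Implicit Types x y t s : R.

Lemma ler_cos x y : 0 <= x <= y -> y <= pi -> cos y <= cos x.
Proof.
move=> /andP[x0]; rewrite le_eqVlt => /predU1P[->//|xy ypi]; apply: ltW.
by rewrite ltr_cos // in_itv /=; apply/andP; split; lra.
Qed.

(** The mean value theorem gives sin(x/2) >= (x/2) cos(x/2), and doubling the angle yields sin x >=
    x cos(x/2)^2 = x (1 + cos x)/2. *)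
Lemma sin_ge_half x : 0 <= x <= pi / 2 -> x / 2 <= sin x.
Proof.
move=> /andP[x0 xpi]; have pi0 := pi_gt0 R.
have [->|xn0] := eqVneq x 0; first by rewrite sin0 mul0r.
have {xn0} x0 : 0 < x by rewrite lt_neqAle eq_sym xn0.
have h0 : 0 < x / 2 by lra.
have [c] := @MVT R sin cos 0 (x / 2) h0 (fun x _ => is_derive_sin x)
  (continuous_subspaceT (@continuous_sin R)).
rewrite in_itv /= sin0 !subr0 => /andP[c0 cx] sE.
have cc : cos (x / 2) <= cos c.
  by apply: ler_cos; lra.
have ch : 0 <= cos (x / 2) by apply: cos_ge0_pihalf; lra.
have E2 : x / 2 *+ 2 = x by rewrite -mulr_natr divfK.
have := cos_mulr2n (x / 2); have := sin_mulr2n (x / 2); rewrite E2 sE => -> cE.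
have cx0 : 0 <= cos x by apply: cos_ge0_pihalf; lra.
rewrite -[_ *+ 2](@mulr_natr R) in cE; rewrite -[leRHS]mulr_natr.
have AB : cos (x / 2) ^+ 2 <= cos (x / 2) * cos c by rewrite expr2 ler_wpM2l.
rewrite mulrA [leLHS](_ : _ = 1 / 2 * (x / 2) * 2); last by field.
by rewrite ler_pM2r // ler_pM2r //; lra.
Qed.

(** The difference is 2 sin m sin h with m the midpoint and h the half-distance, and sin m >= sin h
    because h <= m <= pi - h. The quadratic order is the right one, since the cosine is flat at 0
    and pi. *)
Lemma cosB_ge x y : 0 <= x <= y -> y <= pi -> (y - x) ^+ 2 / 8 <= cos x - cos y.
Proof.
move=> /andP[x0 xy] ypi; have pi0 := pi_gt0 R.
set h := (y - x) / 2; set m := (x + y) / 2.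
have -> : cos x - cos y = 2 * (sin m * sin h).
  have -> : x = m - h by rewrite /m /h; lra.
  have -> : y = m + h by rewrite /m /h; lra.
  by rewrite cosB cosD; ring.
have hh : h / 2 <= sin h by apply: sin_ge_half; rewrite /h; lra.
have h0 : 0 <= h / 2 by rewrite /h; lra.
have mh : sin h <= sin m.
  rewrite -subr_ge0.
  have -> : sin m - sin h = 2 * (cos (y / 2) * sin (x / 2)).
    have -> : m = y / 2 + x / 2 by rewrite /m; lra.
    have -> : h = y / 2 - x / 2 by rewrite /h; lra.
    by rewrite sinB sinD; ring.
  apply: mulr_ge0 => //; apply: mulr_ge0.
    by apply: cos_ge0_pihalf; lra.
  by apply: sin_ge0_pi; lra.
have -> : (y - x) ^+ 2 / 8 = 2 * (h / 2 * (h / 2)) by rewrite /h; field.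
rewrite ler_pM2l //; apply: ler_pM => //; exact: le_trans hh mh.
Qed.

Lemma cos_geo_bound s : 0 <= s <= pi / 2 -> cos (2 * s) <= 1 - s ^+ 2 / 2.
Proof.
move=> /andP[s0 spi]; have pi0 := pi_gt0 R.
have : (2 * s - 0) ^+ 2 / 8 <= cos 0 - cos (2 * s) by apply: cosB_ge; lra.
by rewrite cos0 subr0 exprMn; lra.
Qed.

(* [acos \o (al * cos + be)] has derivative [al sin x / sqrt (1 - c^2)] with
   [c = al cos x + be]; its square is at most
   [1 + (al^2 - 1 + 2 |be|) / (1 - c^2)]. *)
Lemma acos_affine_cos_lipschitz (al be eta L x y : R) :
  0 < al -> 0 < eta <= 1 -> 1 <= L ->
  al ^+ 2 - 1 + 2 * `|be| <= (L ^+ 2 - 1) * eta ->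
  0 <= x <= pi -> 0 <= y <= pi ->
  `|al * cos x + be| <= 1 - eta -> `|al * cos y + be| <= 1 - eta ->
  `|acos (al * cos x + be) - acos (al * cos y + be)| <= L * `|x - y|.
Proof.
move=> al0 /andP[e0 e1] L1 hL.
wlog xy : x y / x <= y.
  move=> W hx hy bx by_; case: (leP x y) => [xy|/ltW yx]; first exact: W.
  by rewrite distrC (distrC x); exact: W.
move=> /andP[x0 xpi] /andP[y0 ypi] bx by_.
pose f z := acos (al * cos z + be).
have bz z : z \in `[x, y] -> `|al * cos z + be| <= 1 - eta.
  rewrite in_itv /= => /andP[xz zy].
  have c1 : cos z <= cos x by apply: ler_cos; lra.
  have c2 : cos y <= cos z by apply: ler_cos; lra.
  have := ler_wpM2l (ltW al0) c1; have := ler_wpM2l (ltW al0) c2.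
  move: bx by_; rewrite !ler_norml => /andP[? ?] /andP[? ?] ? ?.
  by apply/andP; split; lra.
pose df z := (- (Num.sqrt (1 - (al * cos z + be) ^+ 2))^-1) * (al * - sin z).
have fd z : z \in `[x, y] -> is_derive z 1 f (df z).
  move=> /bz; rewrite ler_norml => /andP[b1 b2].
  have b3 : -1 < al * cos z + be < 1 by apply/andP; split; lra.
  have D1 : is_derive z 1 (fun z => al * cos z + be) (al * - sin z).
    by apply: is_derive_eq; rewrite /GRing.scale /= ; ring.
  have := is_derive1_acos b3 => D2.
  exact: is_derive1_comp.
have cf : {within `[x, y], continuous f}.
  apply: continuous_in_subspaceT => z; rewrite inE => zxy.
  by apply/differentiable_continuous/derivable1_diffP; case: (fd z zxy).
have fd' z : z \in `]x, y[ -> is_derive z 1 f (df z).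
  by rewrite in_itv /= => /andP[? ?]; apply: fd; rewrite in_itv /= !ltW.
have [c cxy E] := @MVT_segment R f df x y xy fd' cf.
rewrite -/(f x) -/(f y) distrC E normrM (distrC x y).
apply: ler_wpM2r => //.
rewrite /df; set C := al * cos c + be.
have bc := bz _ cxy; rewrite -/C in bc.
have C2 : C ^+ 2 <= 1 - eta.
  rewrite -real_normK ?num_real //; have := normr_ge0 C.
  move: bc; set N := `|C|; nra.
have q0 : 0 < Num.sqrt (1 - C ^+ 2) by rewrite sqrtr_gt0; lra.
rewrite normrM normrN normfV (gtr0_norm q0) normrM normrN (gtr0_norm al0).
rewrite ler_pdivrMl // mulrC.
have s0 : 0 <= sin c.
  by apply: sin_ge0_pi; move: cxy; rewrite in_itv /=; lra.
rewrite (ger0_norm s0) -(@ler_pXn2r _ 2) // ?nnegrE; last 2 first.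
- by rewrite mulr_ge0 // ltW.
- by rewrite mulr_ge0 ?sqrtr_ge0 //; lra.
rewrite !exprMn sqr_sqrtr; last by lra.
rewrite sin2cos2 mulrBl mul1r -exprMn.
have -> : cos c * al = C - be by rewrite /C; ring.
have : C * be <= `|be|.
  apply: le_trans (ler_norm _) _; rewrite normrM ler_piMl //.
  by apply: le_trans bc _; lra.
have : 0 <= be ^+ 2 by exact: sqr_ge0.
have : (L ^+ 2 - 1) * eta <= (L ^+ 2 - 1) * (1 - C ^+ 2).
  by apply: ler_wpM2l; [nra|lra].
by move: hL; set N := `|be|; lra.
Qed.

End trig.

(** * Integrals and means over a uniform angle *)

Section circle.
Context {R : realType}.
Local Notation leb := (@lebesgue_measure R).
Implicit Types (a b c : R) (f G H : R -> \bar R).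
Local Open Scope ereal_scope.

Lemma ge0_integral_shift_le a b c f : measurable_fun setT f ->
  (forall x, 0 <= f x) ->
  \int[leb]_(x in `[a, b[) f (x + c)%R <=
  \int[leb]_(x in `[(a + c)%R, (b + c)%R[) f x.
Proof.
move=> mf f0; rewrite -[leRHS]mul1e.
apply: (@ge0_integral_expanding R `[a, b[%classic 1 (fun x => x + c)%R) => //.
- by apply: measurable_funD.
- by move=> x y _ _; rewrite mul1r opprD addrACA subrr addr0.
- by move=> x /=; rewrite !in_itv /= lerD2r ltrD2r.
Qed.

Lemma ge0_integral_shift a b c f : measurable_fun setT f ->
  (forall x, 0 <= f x) ->
  \int[leb]_(x in `[a, b[) f (x + c)%R =
  \int[leb]_(x in `[(a + c)%R, (b + c)%R[) f x.
Proof.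
move=> mf f0; apply/eqP; rewrite eq_le ge0_integral_shift_le //=.
have mfc : measurable_fun setT (fun x : R => f (x + c)%R).
  by apply: (measurableT_comp mf); exact: measurable_funD.
have := @ge0_integral_shift_le (a + c) (b + c) (- c) _ mfc (fun x => f0 _).
by rewrite !addrK; under eq_integral do rewrite subrK.
Qed.

Lemma ge0_integral_split a b c f : (a <= b <= c)%R -> measurable_fun setT f ->
  (forall x, 0 <= f x) ->
  \int[leb]_(x in `[a, c[) f x =
  \int[leb]_(x in `[a, b[) f x + \int[leb]_(x in `[b, c[) f x.
Proof.
move=> /andP[ab bc] mf f0.
have -> : `[a, c[%classic = (`[a, b[ `|` `[b, c[)%classic :> set R.
  by rewrite -itv_bndbnd_setU ?bnd_simp.
rewrite ge0_integral_setU //; first exact: measurable_funTS.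
rewrite disj_set2E; apply/eqP; rewrite -subset0 => x [] /=.
by rewrite !in_itv /= => /andP[_ xb] /andP[bx _]; have := lt_le_trans xb bx; rewrite ltxx.
Qed.

Lemma ge0_integral_period_shift c f : (0 <= c < 2 * pi)%R ->
  measurable_fun setT f -> (forall x, 0 <= f x) ->
  (forall x, f (x + 2 * pi)%R = f x) ->
  \int[leb]_(x in `[0%R, (2 * pi)%R[) f (x + c)%R =
  \int[leb]_(x in `[0%R, (2 * pi)%R[) f x.
Proof.
move=> /andP[c0 c2] mf f0 fp; have pi0 := pi_gt0 R.
rewrite ge0_integral_shift // add0r.
rewrite (@ge0_integral_split c (2 * pi)) //; last by apply/andP; split; lra.
rewrite [RHS](@ge0_integral_split 0 c) //; last by apply/andP; split; lra.
rewrite addeC; congr (_ + _).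
rewrite -[X in `[X, _[](add0r (2 * pi)%R) (addrC (2 * pi)%R).
rewrite -ge0_integral_shift //.
by apply: eq_integral => x _; rewrite fp.
Qed.

(** Quadrants are the pieces on which cos(2x) is injective, so that a relation between cos(2x) and
    cos(2y) defines a map of angles. *)
Lemma ge0_integral_quadrants f : measurable_fun setT f -> (forall x, 0 <= f x) ->
  \int[leb]_(x in `[0%R, (2 * pi)%R[) f x =
  \int[leb]_(x in `[0%R, (pi / 2)%R[) f x +
  (\int[leb]_(x in `[0%R, (pi / 2)%R[) f (x + pi / 2)%R +
  (\int[leb]_(x in `[0%R, (pi / 2)%R[) f (x + pi)%R +
   \int[leb]_(x in `[0%R, (pi / 2)%R[) f (x + (pi + pi / 2))%R)).
Proof.
move=> mf f0; have pi0 := pi_gt0 R.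
rewrite (@ge0_integral_split 0 (pi / 2)) //; last by apply/andP; split; lra.
rewrite (@ge0_integral_split (pi / 2) pi) //; last by apply/andP; split; lra.
rewrite (@ge0_integral_split pi (pi + pi / 2)) //; last by apply/andP; split; lra.
rewrite !ge0_integral_shift // !add0r.
have -> : (pi / 2 + pi / 2 = pi :> R)%R by lra.
have -> : (pi / 2 + pi = pi + pi / 2 :> R)%R by lra.
by have -> : (pi / 2 + (pi + pi / 2) = 2 * pi :> R)%R by lra.
Qed.

Lemma lebesgue_measure_co a b : (a <= b)%R -> leb `[a, b[%classic = (b - a)%:E.
Proof.
rewrite le_eqVlt => /predU1P[->|ab]; rewrite lebesgue_measure_itv /= lte_fin.
  by rewrite ltxx subrr.
by rewrite ab EFinB.
Qed.

Lemma integral_co_le a b (r : R) f : (a <= b)%R -> measurable_fun setT f ->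
  (forall x, 0 <= f x) -> (forall x, f x <= r%:E) ->
  \int[leb]_(x in `[a, b[) f x <= (r * (b - a))%:E.
Proof.
move=> ab mf f0 fr; apply: (@le_trans _ _ (\int[leb]_(x in `[a, b[) cst r%:E x)).
  by apply: ge0_le_integral => //; exact: measurable_funTS.
by rewrite integral_cst //= lebesgue_measure_co // EFinM.
Qed.

(* The map sending psi to the phi with cos 2psi = al cos 2phi + be expands
   distances by at least 1/L away from the ends of the quadrant. *)
Lemma quadrant_coupling G H (al be s : R) :
  (0 < s <= 1 / 8)%R -> (`|al - 1| <= s ^+ 3)%R -> (`|be| <= s ^+ 3)%R ->
  measurable_fun setT G -> measurable_fun setT H ->
  (forall x, 0 <= G x <= 1) -> (forall x, 0 <= H x) ->
  (forall x y, (0 <= x < pi / 2)%R -> (0 <= y < pi / 2)%R ->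
     (cos (2 * x) = al * cos (2 * y) + be)%R -> G x <= H y) ->
  \int[leb]_(x in `[0%R, (pi / 2)%R[) G x <=
  \int[leb]_(x in `[0%R, (pi / 2)%R[) H x + (12 * s)%:E.
Proof.
move=> /andP[s0 s1] hal hbe mG mH G01 H0 GH; have pi0 := pi_gt0 R.
have pi4 : (pi / 2 <= 2 :> R)%R by have [/andP[]] := pihalf_02_cos_pihalf R.
have pi1 := pihalf_ge1 R.
have G0 x : 0 <= G x by case/andP: (G01 x).
have s3 : (s ^+ 3 <= s ^+ 2 / 8)%R by rewrite exprS; nra.
have s3p : (0 < s ^+ 3)%R by rewrite exprn_gt0.
have s2p : (0 < s ^+ 2)%R by rewrite exprn_gt0.
(* [G <= 1] permits this truncation of [H], after which the factor [L] costs at most (L - 1) times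
   the length of the quadrant. *)
pose M x := mine 1 (H x).
have mM : measurable_fun setT M by apply: measurable_mine.
have M0 x : 0 <= M x by rewrite /M le_min lee01 H0.
(* The margin [s] at both ends keeps cos(2x) away from 1 and -1, where acos is not Lipschitz. As
   [G <= 1], it costs 2s. *)
pose D := `[s, (pi / 2 - s)%R[%classic : set R.
pose tau0 x : R := (acos ((cos (2 * x) - be) / al) / 2)%R.
have mD : measurable D by exact: measurable_itv.
pose tau := tau0 \_ D.
have al0 : (0 < al)%R by move: hal; rewrite ler_norml => /andP[? ?]; nra.
have Dcos x : D x -> (`|cos (2 * x)| <= 1 - s ^+ 2 / 2)%R.
  rewrite /D /= in_itv /= => /andP[sx xs].
  have c1 : (cos (2 * x) <= cos (2 * s))%R by apply: ler_cos; lra.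
  have c2 : (cos (pi - 2 * s) <= cos (2 * x))%R by apply: ler_cos; lra.
  have c3 : (cos (2 * s) <= 1 - s ^+ 2 / 2)%R by apply: cos_geo_bound; lra.
  have c4 : (cos (pi - 2 * s) = - cos (2 * s))%R by rewrite addrC cosDpi cosN.
  by rewrite ler_norml; apply/andP; split; lra.
have arg x : D x -> (`|(cos (2 * x) - be) / al| < 1)%R.
  move=> /Dcos; rewrite normrM normfV (gtr0_norm al0) ltr_pdivrMr // mul1r.
  move: hal hbe; rewrite !ler_norml ltr_norml => /andP[? ?] /andP[? ?] /andP[? ?].
  by apply/andP; split; lra.
have tauE x : D x -> tau x = tau0 x by move=> Dx; rewrite /tau /patch mem_set.
have tau_cos x : D x ->
    [/\ (0 <= 2 * tau x <= pi)%R, (0 <= tau x < pi / 2)%R &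
        (cos (2 * x) = al * cos (2 * tau x) + be)%R].
  move=> Dx; rewrite (tauE _ Dx) /tau0; have := arg _ Dx.
  rewrite ltr_norml; set z := (_ / al)%R => /andP[z1 z2].
  have -> : (2 * (acos z / 2) = acos z)%R by field.
  have h0 : (0 <= acos z)%R by apply: acos_ge0; lra.
  have h1 : (acos z < pi)%R by apply: acos_ltpi; lra.
  split; [lra|lra|].
  by rewrite acosK ?in_itv /=; [rewrite /z; field; lra|lra].
have mtau : measurable_fun setT tau.
  apply: (iffLR (measurable_restrictT _ mD)).
  apply: subspace_continuous_measurable_fun => //.
  apply: continuous_in_subspaceT => x; rewrite inE => /arg ax.
  have cc : {for x, continuous (fun y : R => (cos (2 * y) - be) / al : R)%R}.
    apply: cvgM; last exact: cvg_cst.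
    apply: cvgB; last exact: cvg_cst.
    apply: continuous_comp; last exact: continuous_cos.
    by apply: cvgM; [exact: cvg_cst|exact: cvg_id].
  apply: cvgM; last exact: cvg_cst.
  apply: continuous_comp => //; apply: continuous_acos.
  by move: ax; rewrite ltr_norml.
(* With eta = s^2/2 this gives (L^2 - 1) eta >= 5 s^3, which covers al^2 - 1 + 2|be| <= 3 s^3 + 2
   s^3. *)
pose L := (1 + 5 * s)%R.
have tau_exp x y : D x -> D y -> (`|x - y| <= L * `|tau x - tau y|)%R.
  move=> Dx Dy; have [x1 x2 x3] := tau_cos _ Dx; have [y1 y2 y3] := tau_cos _ Dy.
  (* The Lipschitz map is the inverse of [tau], up to the doubling of angles, so its constant is the
     expansion constant of [tau]. *)
  have := @acos_affine_cos_lipschitz R al be (s ^+ 2 / 2) L (2 * tau x) (2 * tau y) al0.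
  rewrite -x3 -y3 => lip.
  have Dpi z : D z -> (0 <= 2 * z <= pi)%R.
    by rewrite /D /= in_itv /= => /andP[? ?]; lra.
  have cK z : D z -> acos (cos (2 * z)) = (2 * z)%R by move=> Dz; rewrite cosK // in_itv /= Dpi.
  rewrite (cK x) // (cK y) // in lip.
  have -> : (x - y = (2 * x - 2 * y) / 2)%R by field.
  rewrite normrM (ger0_norm (_ : 0 <= 2^-1)%R) //.
  have e : (`|2 * tau x - 2 * tau y| = 2 * `|tau x - tau y|)%R.
    by rewrite -mulrBr normrM ger0_norm.
  rewrite e in lip; rewrite ler_pdivrMr //.
  have -> : (L * `|tau x - tau y| * 2 = L * (2 * `|tau x - tau y|))%R by ring.
  apply: lip => //; [nra|by rewrite /L; lra| |exact: Dcos|exact: Dcos].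
  rewrite /L; move: hal; rewrite ler_norml => /andP[a1 a2].
  have : (al ^+ 2 - 1 <= 3 * s ^+ 3)%R by nra.
  have -> : (((1 + 5 * s) ^+ 2 - 1) * (s ^+ 2 / 2) = 5 * s ^+ 3 + 25 / 2 * s ^+ 4)%R by field.
  have : (0 <= s ^+ 4)%R by rewrite exprn_ge0 ?ltW.
  lra.
have L0 : (0 < L)%R by rewrite /L; lra.
have mid : \int[leb]_(x in D) G x <=
    \int[leb]_(x in `[0%R, (pi / 2)%R[) H x + (10 * s)%:E.
  apply: (@le_trans _ _ (\int[leb]_(x in D) M (tau x))).
    apply: ge0_le_integral => //; [exact: measurable_funTS| |].
      by apply: measurable_funTS; exact: measurableT_comp.
    move=> x Dx; have [_ x2 x3] := tau_cos _ Dx.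
    rewrite /M le_min; apply/andP; split; first by case/andP: (G01 x).
    apply: GH => //; by move: Dx; rewrite /D /= in_itv /= => /andP[? ?]; lra.
  apply: le_trans (ge0_integral_expanding _ L0 mtau tau_exp _ mM M0 _) _.
  - by [].
  - exact: measurable_itv `[0%R, (pi / 2)%R[.
  - by move=> x /tau_cos[].
  rewrite /L EFinD ge0_muleDl ?lee_fin ?mul1e //; last by lra.
  apply: leeD.
    apply: ge0_le_integral => //; [exact: measurable_funTS|exact: measurable_funTS|].
    by move=> x _; rewrite /M ge_min lexx orbT.
  apply: (@le_trans _ _ ((5 * s)%:E * 2)).
    apply: lee_wpmul2l; first by rewrite lee_fin; lra.
    apply: le_trans (integral_co_le (r := 1) _ mM M0 _) _; first by lra.
      by move=> x; rewrite /M ge_min lexx.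
    by rewrite lee_fin; lra.
  by rewrite -EFinM lee_fin; lra.
have short (a b : R) : (a <= b)%R -> \int[leb]_(x in `[a, b[) G x <= (b - a)%:E.
  move=> ab; rewrite -[leRHS]mul1e -EFinM; apply: integral_co_le => //.
  by move=> x; case/andP: (G01 x).
rewrite (@ge0_integral_split 0 s) //; last by apply/andP; split; lra.
rewrite (@ge0_integral_split s (pi / 2 - s)) //; last by apply/andP; split; lra.
have h1 : \int[leb]_(x in `[0%R, s[) G x <= s%:E.
  by have := short 0%R s (ltW s0); rewrite subr0.
have h2 : \int[leb]_(x in `[(pi / 2 - s)%R, (pi / 2)%R[) G x <= s%:E.
  have : (pi / 2 - s <= pi / 2 :> R)%R by lra.
  move/short; by have -> : (pi / 2 - (pi / 2 - s) = s)%R by lra.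
apply: le_trans (leeD h1 (leeD mid h2)) _.
rewrite addeCA -addeA; apply: leeD => //.
by rewrite -!EFinD lee_fin; lra.
Qed.

Definition circle_mean f : \bar R :=
  ((2 * pi)^-1)%:E * \int[leb]_(x in `[0%R, (2 * pi)%R[) f x.

Lemma circle_mean_ge0 f : (forall x, 0 <= f x) -> 0 <= circle_mean f.
Proof.
move=> f0; apply: mule_ge0; last exact: integral_ge0.
by rewrite lee_fin invr_ge0 mulr_ge0 // pi_ge0.
Qed.

Lemma circle_mean_shift c f : (0 <= c < 2 * pi)%R ->
  measurable_fun setT f -> (forall x, 0 <= f x) ->
  (forall x, f (x + 2 * pi)%R = f x) ->
  circle_mean (fun x => f (x + c)%R) = circle_mean f.
Proof. by move=> *; rewrite /circle_mean ge0_integral_period_shift. Qed.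

Lemma le_circle_mean f g : measurable_fun setT f -> measurable_fun setT g ->
  (forall x, 0 <= f x) -> (forall x, f x <= g x) ->
  circle_mean f <= circle_mean g.
Proof.
move=> mf mg f0 fg; apply: lee_wpmul2l.
  by rewrite lee_fin invr_ge0 mulr_ge0 // pi_ge0.
by apply: ge0_le_integral => //; exact: measurable_funTS.
Qed.

Lemma circle_meanD f g : measurable_fun setT f -> measurable_fun setT g ->
  (forall x, 0 <= f x) -> (forall x, 0 <= g x) ->
  circle_mean (fun x => f x + g x) = circle_mean f + circle_mean g.
Proof.
move=> mf mg f0 g0; rewrite /circle_mean ge0_integralD //; last 2 first.
- exact: measurable_funTS.
- exact: measurable_funTS.
by rewrite ge0_muleDr //; exact: integral_ge0.
Qed.

Lemma circle_meanZ (k : R) f : (0 <= k)%R -> measurable_fun setT f ->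
  (forall x, 0 <= f x) ->
  circle_mean (fun x => k%:E * f x) = k%:E * circle_mean f.
Proof.
move=> k0 mf f0; rewrite /circle_mean ge0_integralZl_EFin //.
  by rewrite muleCA.
exact: measurable_funTS.
Qed.

Lemma circle_mean_cst (k : \bar R) : circle_mean (fun=> k) = k.
Proof.
rewrite /circle_mean (integral_cst leb) //= lebesgue_measure_co; last first.
  by rewrite mulr_ge0 // pi_ge0.
rewrite subr0 muleCA -EFinM mulVf ?mule1 // mulf_neq0 // gt_eqF //.
exact: pi_gt0.
Qed.

(** Shifting both angles by pi/2 changes the sign of cos(2x), so the other quadrants are
    [quadrant_coupling] with [be] or [- be]. The two sign conditions say that both angles lie in a
    common closed quadrant, which is how signs get matched. *)
Lemma circle_coupling G H (al be s : R) :
  (0 < s <= 1 / 8)%R -> (`|al - 1| <= s ^+ 3)%R -> (`|be| <= s ^+ 3)%R ->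
  measurable_fun setT G -> measurable_fun setT H ->
  (forall x, 0 <= G x <= 1) -> (forall x, 0 <= H x) ->
  (forall x y, (0 <= cos x * cos y)%R -> (0 <= sin x * sin y)%R ->
     (cos (2 * x) = al * cos (2 * y) + be)%R -> G x <= H y) ->
  circle_mean G <= circle_mean H + (12 * s)%:E.
Proof.
move=> hs hal hbe mG mH G01 H0 GH; have pi0 := pi_gt0 R; have pi2 := pi_ge2 R.
have G0 x : 0 <= G x by case/andP: (G01 x).
have cs (x : R) : (0 <= x < pi / 2)%R -> (0 <= cos x)%R /\ (0 <= sin x)%R.
  move=> /andP[? ?]; split; [apply: cos_ge0_pihalf|apply: sin_ge0_pi];
  by apply/andP; split; lra.
have Q (c be' : R) : (`|be'| <= s ^+ 3)%R ->
    (forall x y, (0 <= x < pi / 2)%R -> (0 <= y < pi / 2)%R ->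
      (cos (2 * x) = al * cos (2 * y) + be')%R ->
      [/\ (0 <= cos (x + c) * cos (y + c))%R, (0 <= sin (x + c) * sin (y + c))%R &
      (cos (2 * (x + c)) = al * cos (2 * (y + c)) + be)%R]) ->
    \int[leb]_(x in `[0%R, (pi / 2)%R[) G (x + c)%R <=
    \int[leb]_(x in `[0%R, (pi / 2)%R[) H (x + c)%R + (12 * s)%:E.
  move=> hbe' P.
  apply: (@quadrant_coupling (fun x => G (x + c)%R) (fun x => H (x + c)%R) al be') => //.
  - by apply: (measurableT_comp mG); exact: measurable_funD.
  - by apply: (measurableT_comp mH); exact: measurable_funD.
  by move=> x y hx hy /(P _ _ hx hy)[? ? ?]; apply: GH.
have two (x c : R) : (cos (2 * (x + c)) = cos (2 * x + c + c))%R.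
  by congr cos; ring.
have Q0 := Q 0%R be hbe; have Q1 := Q (pi / 2)%R (- be)%R.
have Q2 := Q pi be hbe; have Q3 := Q (pi + pi / 2)%R (- be)%R.
rewrite normrN in Q1 Q3.
apply: (@le_trans _ _ (circle_mean H + ((2 * pi)^-1)%:E * (4 * (12 * s))%:E)).
  rewrite /circle_mean -ge0_muleDr; last 2 first.
  - exact: integral_ge0.
  - by rewrite lee_fin; lra.
  apply: lee_wpmul2l; first by rewrite lee_fin invr_ge0; lra.
  rewrite (ge0_integral_quadrants mG G0) (ge0_integral_quadrants mH H0).
  have -> : (4 * (12 * s))%:E = (12 * s)%:E + ((12 * s)%:E + ((12 * s)%:E + (12 * s)%:E)) :> \bar R.
    by rewrite -!EFinD; congr EFin; ring.
  have A (a b c d e f g h : \bar R) :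
      a + (b + (c + d)) + (e + (f + (g + h))) = a + e + (b + f + (c + g + (d + h))).
    by rewrite addeACA; congr (_ + _); rewrite addeACA; congr (_ + _); rewrite addeACA.
  rewrite A; apply: leeD; last apply: leeD; last apply: leeD.
  - have E (F : R -> \bar R) : \int[leb]_(x in `[0%R, (pi / 2)%R[) F (x + 0)%R =
        \int[leb]_(x in `[0%R, (pi / 2)%R[) F x.
      by apply: eq_integral => x _; rewrite addr0.
    rewrite -(E G) -(E H).
    apply: Q0 => x y /cs[? ?] /cs[? ?] e; rewrite !addr0; split => //; exact: mulr_ge0.
  - apply: Q1 => // x y /cs[? ?] /cs[? ?] e.
    rewrite !two !(cosDpihalf, sinDpihalf) mulrNN; split; [exact: mulr_ge0..|].
    by rewrite e; ring.
  - apply: Q2 => // x y /cs[? ?] /cs[? ?] e.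
    rewrite !two !cosDpi !sinDpi !mulrNN !opprK; split => //; exact: mulr_ge0.
  - apply: Q3 => // x y /cs[? ?] /cs[? ?] e.
    have c3 (z : R) : (cos (z + (pi + pi / 2)) = sin z)%R.
      by rewrite addrA cosDpihalf sinDpi opprK.
    have s3 (z : R) : (sin (z + (pi + pi / 2)) = - cos z)%R.
      by rewrite addrA sinDpihalf cosDpi.
    rewrite !two !(c3, s3) !mulrNN.
    split; [exact: mulr_ge0..|].
    by rewrite e; ring.
(* Four quadrants give 48s/(2 pi), at most 12s since pi >= 2. *)
apply: leeD => //; rewrite -EFinM lee_fin mulrC ler_pdivrMr; last by lra.
by case/andP: hs => ? ?; nra.
Qed.

Lemma measurable_cosM (rho : R) : measurable_fun setT (fun x : R => rho * cos x)%R.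
Proof.
apply: continuous_measurable_fun => x.
by apply: cvgM; [exact: cvg_cst|exact: continuous_cos].
Qed.

Lemma measurable_sinM (rho : R) : measurable_fun setT (fun x : R => rho * sin x)%R.
Proof.
apply: continuous_measurable_fun => x.
by apply: cvgM; [exact: cvg_cst|exact: continuous_sin].
Qed.

Lemma measurable_indic_cosM (rho a b : R) :
  measurable_fun setT (fun x : R => (\1_`[a, b] (rho * cos x)%R)%:E : \bar R).
Proof.
apply/measurable_EFinP; apply: measurableT_comp (measurable_cosM rho).
by apply: measurable_indic; exact: measurable_itv.
Qed.

(** By [cosB_ge], two angles of the half circle at which rho cos x lies in a window of width 2t
    differ by at most 4 sqrt(t/rho). *)
Lemma half_circle_small_ball (rho c t : R) : (0 < rho)%R -> (0 <= t)%R ->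
  \int[leb]_(x in `[0%R, pi[) (\1_`[(c - t)%R, (c + t)%R] (rho * cos x)%R)%:E
  <= (4 * Num.sqrt (t / rho))%:E.
Proof.
move=> rho0 t0.
pose S := (fun x => rho * cos x)%R @^-1` `[(c - t)%R, (c + t)%R]%classic.
have mS : measurable S.
  by rewrite -[S]setTI; apply: measurable_cosM => //; exact: measurable_itv.
rewrite (_ : (fun x => _) = (fun x => (\1_S x)%:E)) //.
rewrite integral_indic //.
have h : (0 <= 4 * Num.sqrt (t / rho))%R by rewrite mulr_ge0 // sqrtr_ge0.
rewrite -(max_r h); apply: lebesgue_measure_diam; first exact: measurableI.
have q0 : (0 <= t / rho)%R by rewrite divr_ge0 // ltW.
move=> x y [Sx /=]; rewrite in_itv /= => /andP[x0 xpi] [Sy /=]; rewrite in_itv /= => /andP[y0 ypi].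
have [xy|/ltW yx] := leP x y; last by apply: le_trans h; lra.
have cb : ((y - x) ^+ 2 / 8 <= cos x - cos y)%R by apply: cosB_ge; [apply/andP; split|]; lra.
have ct : (cos x - cos y <= 2 * (t / rho))%R.
  rewrite mulrA ler_pdivlMr // mulrC mulrBr.
  by move: Sx Sy; rewrite /S /= !in_itv /= => /andP[? ?] /andP[? ?]; lra.
rewrite -(@ler_pXn2r _ 2) // ?nnegrE ?subr_ge0 // exprMn sqr_sqrtr //.
lra.
Qed.

Lemma circle_mean_small_ball_cos (rho c t : R) : (0 < rho)%R -> (0 <= t)%R ->
  circle_mean (fun x => (\1_`[(c - t)%R, (c + t)%R] (rho * cos x)%R)%:E)
  <= (2 * Num.sqrt (t / rho))%:E.
Proof.
move=> rho0 t0; have pi0 := pi_gt0 R; have pi2 := pi_ge2 R.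
set f := (fun x => _).
have mf : measurable_fun setT f by exact: measurable_indic_cosM.
have f0 x : 0 <= f x by rewrite lee_fin.
rewrite /circle_mean (@ge0_integral_split 0 pi) //; last by apply/andP; split; lra.
rewrite muleC lee_pdivrMr; last by lra.
apply: (@le_trans _ _ ((4 * Num.sqrt (t / rho))%:E + (4 * Num.sqrt (t / rho))%:E)).
  apply: leeD; first exact: half_circle_small_ball.
  (* On the second half circle the cosine changes sign: the same bound applies with centre [- c]. *)
  rewrite (_ : `[pi, (2 * pi)%R[%classic = `[(0 + pi)%R, (pi + pi)%R[%classic).
    rewrite -ge0_integral_shift //.
    apply: le_trans (@half_circle_small_ball rho (- c) t rho0 t0).
    apply: ge0_le_integral => //.
    - apply: measurable_funTS; apply: (measurableT_comp mf).
      exact: measurable_funD.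
    - by apply: measurable_funTS; exact: measurable_indic_cosM.
    move=> x _; rewrite /f cosDpi lee_fin !indicE !mem_setE !in_itv /=.
    rewrite mulrN lerNr lerNl !opprD !opprK.
    by rewrite andbC addrC.
  by congr (fun x y => `[x, y[%classic); lra.
rewrite -EFinD -EFinM lee_fin; have := sqrtr_ge0 (t / rho)%R; nra.
Qed.

End circle.

(** * One step of the walk *)

Section measurable_Rn.
Context {R : realType} {n : nat}.

Lemma measurable_coord (i : 'I_n) :
  measurable_fun setT (fun x : Rn R n => (x : 'rV[R]_n) ord0 i).
Proof.
suff : @measurable_fun _ _ (Rn R n) (measurableTypeR R) setT
    (fun x : Rn R n => (x : 'rV[R]_n) ord0 i) by [].
apply: (@measurability _ _ (Rn R n) (measurableTypeR R) setT _ _ (RGenOpens.measurableE R)) => _ [_ [a [b ->]] <-].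
rewrite setTI; apply: sub_sigma_algebra.
by apply: open_comp; [move=> x _; exact: coord_continuous|exact: interval_open].
Qed.

Let rat_box (q : 'rV[rat]_n * nat) : set 'rV[R]_n :=
  [set y | forall i, `|y ord0 i - ratr (q.1 ord0 i)| < q.2.+1%:R^-1].

(** There are countably many such boxes, which reduces measurability of a map into R^n to that of
    its coordinates. *)
Let open_rat_box (U : set 'rV[R]_n) : open U ->
  U = \bigcup_(q in [set q | rat_box q `<=` U]) rat_box q.
Proof.
move=> oU; apply/seteqP; split => [x Ux|x [q /= qU]]; last exact: qU.
have /nbhs_ballP[e /= e0 eU] : nbhs x U by exact: open_nbhs_nbhs.
(* The rational centre is within one radius of [x], so the box lies within two radii of [x]. *)
have [m me] : exists m : nat, m.+1%:R^-1 < e / 2.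
  have e2 : 0 < e / 2 by rewrite divr_gt0.
  by have [m _ hm] := near_infty_natSinv_lt (PosNum e2); exists m; apply: hm => /=.
have m0 : 0 < (m.+1%:R^-1 : R) by rewrite invr_gt0.
have qx i : {q : rat | `|x ord0 i - ratr q| < m.+1%:R^-1}.
  apply: cid; have [||y [xy [q _ qy]]] := @dense_rat R (ball (x ord0 i) m.+1%:R^-1).
  - by exists (x ord0 i); exact: ballxx.
  - exact: ball_open.
  by exists q; rewrite qy; exact: xy.
exists (\row_i sval (qx i), m).
- move=> y /= hy; apply: eU; split => // i j; rewrite (ord1 i).
  have vv : m.+1%:R^-1 + m.+1%:R^-1 < e by move: me; set v := _^-1; lra.
  apply: lt_trans vv; apply: (@le_lt_trans _ _ (`|x ord0 j - ratr (sval (qx j))| + `|y ord0 j - ratr (sval (qx j))|)).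
    by rewrite (distrC (y _ _)); apply: ler_distD.
  apply: ltrD; first exact: (svalP (qx j)).
  by have := hy j; rewrite mxE.
- by move=> i /=; rewrite mxE; exact: (svalP (qx i)).
Qed.

Lemma measurable_fun_Rn d (T : measurableType d) (f : T -> Rn R n) :
  (forall i, measurable_fun setT (fun t => (f t : 'rV[R]_n) ord0 i)) ->
  measurable_fun setT f.
Proof.
move=> mf; apply: (@measurability _ _ T (Rn R n) setT f (@open 'rV[R]_n)) => // _ [U oU <-].
rewrite setTI (open_rat_box oU) preimage_bigcup bigcup_mkcond.
apply: countable_bigcupT_measurable => [|q]; first exact: countableP.
case: ifP => // _.
have -> : f @^-1` rat_box q =
    \bigcap_(i in [set: 'I_n]) ((fun t => (f t : 'rV[R]_n) ord0 i) @^-1`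
       [set y | `|y - ratr (q.1 ord0 i)| < q.2.+1%:R^-1]).
  by apply/seteqP; split => [t /= H i _|t H i] /=; [exact: H|exact: (H i)].
apply: fin_bigcap_measurable => // i _.
rewrite -[_ @^-1` _]setTI; apply: mf => //.
have -> : [set y : R | `|y - ratr (q.1 ord0 i)| < q.2.+1%:R^-1] =
    ball (ratr (q.1 ord0 i) : R) q.2.+1%:R^-1.
  by apply/seteqP; split => y; rewrite /ball /= distrC.
exact: measurable_ball.
Qed.

End measurable_Rn.

Section step.
Context {R : realType} {n : nat}.
Local Notation leb := (@lebesgue_measure R).
Implicit Types (i j k : 'I_n) (f g : Rn R n -> \bar R) (x y : Rn R n).
Local Open Scope ereal_scope.

Definition put i j (a b : R) x : Rn R n :=
  \row_k (if k == i then a else if k == j then b else (x : 'rV[R]_n) ord0 k)%R.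

Definition pair_norm i j x : R :=
  Num.sqrt (((x : 'rV[R]_n) ord0 i) ^+ 2 + ((x : 'rV[R]_n) ord0 j) ^+ 2)%R.

Definition polar i j x (phi : R) : Rn R n :=
  put i j (pair_norm i j x * cos phi)%R (pair_norm i j x * sin phi)%R x.

Definition step i j f x : \bar R := circle_mean (fun th => f (kac_rot i j th x)).

Lemma pair_norm_ge0 i j x : (0 <= pair_norm i j x)%R.
Proof. exact: sqrtr_ge0. Qed.

Lemma sqr_pair_norm i j x : (pair_norm i j x ^+ 2 =
  ((x : 'rV[R]_n) ord0 i) ^+ 2 + ((x : 'rV[R]_n) ord0 j) ^+ 2)%R.
Proof. by rewrite sqr_sqrtr // addr_ge0 ?sqr_ge0. Qed.

Lemma polar_angle i j x : exists2 a : R, (0 <= a < 2 * pi)%R &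
  ((x : 'rV[R]_n) ord0 i = pair_norm i j x * cos a)%R /\
  ((x : 'rV[R]_n) ord0 j = pair_norm i j x * sin a)%R.
Proof.
have pi0 := pi_gt0 R.
have := sqr_pair_norm i j x; have := pair_norm_ge0 i j x.
set r := pair_norm i j x; set u := (_ ord0 i)%R; set v := (_ ord0 j)%R.
rewrite le_eqVlt => /predU1P[<-|r0] ruv.
  exists 0%R; first by apply/andP; split; lra.
  by rewrite !mul0r; split; apply/eqP; rewrite -sqrf_eq0; nra.
have c1 : (-1 <= u / r <= 1)%R.
  by rewrite lerNl -mulNr !ler_pdivrMr // mul1r; apply/andP; split; nra.
have ur : (u = r * cos (acos (u / r)))%R.
  by rewrite acosK ?in_itv //= mulrC divfK // gt_eqF.
have vr : (r * sin (acos (u / r)) = `|v|)%R.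
  have s0 : (0 <= sin (acos (u / r)))%R.
    by apply: sin_ge0_pi; rewrite acos_ge0 // acos_lepi.
  apply/eqP; rewrite -(@eqrXn2 _ 2) // ?mulr_ge0 ?(ltW r0) //.
  rewrite exprMn sin2cos2 acosK ?in_itv // real_normK ?num_real //.
  have -> : (r ^+ 2 * (1 - (u / r) ^+ 2) = r ^+ 2 - u ^+ 2)%R by field; rewrite gt_eqF.
  by rewrite ruv addrAC subrr add0r.
have := acos_ge0 c1; have := acos_lepi c1.
have [v0|v0] := leP 0%R v; move=> api a0.
  exists (acos (u / r)); first by apply/andP; split; lra.
  by split => //; rewrite vr ger0_norm.
(* A zero arccosine would force v = 0; excluding it keeps the angle strictly below 2 pi. *)
have a00 : (acos (u / r) != 0)%R.
  apply/eqP => a00; move: vr; rewrite a00 sin0 mulr0 => /esym/eqP.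
  by rewrite normr_eq0 lt_eqF.
have a1 : (0 < acos (u / r))%R by rewrite lt_neqAle eq_sym a00.
exists (2 * pi - acos (u / r))%R; first by apply/andP; split; lra.
have -> : (2 * pi - acos (u / r) = - acos (u / r) + pi *+ 2)%R.
  by rewrite -mulr_natl; ring.
by rewrite cosD2pi sinD2pi cosN sinN mulrN vr ltr0_norm // opprK.
Qed.

Lemma measurable_polar i j x : measurable_fun setT (polar i j x).
Proof.
apply: measurable_fun_Rn => k; under eq_fun do rewrite mxE.
case: eqP => _; first exact: measurable_cosM.
by case: eqP => _; [exact: measurable_sinM|exact: measurable_cst].
Qed.

(** Rotating by a uniform angle adds it to the polar angle of [x], which the uniform law absorbs. A
    step thus resamples the polar angle of the pair, and two chains can share the new angle whatever
    their positions. *)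
Lemma stepE i j f x : measurable_fun setT f -> (forall x, 0 <= f x) ->
  step i j f x = circle_mean (fun phi => f (polar i j x phi)).
Proof.
move=> mf f0; have [a a2 [xi xj]] := polar_angle i j x.
rewrite -(@circle_mean_shift _ a (fun phi => f (polar i j x phi))) //.
- rewrite /step; congr circle_mean; apply/funext => th; congr f.
  apply/rowP => k; rewrite !mxE xi xj cosD sinD.
  by case: eqP => _; [ring|case: eqP => _ //; ring].
- by apply: (measurableT_comp mf); exact: measurable_polar.
- by move=> phi; rewrite /polar mulr_natl cosD2pi sinD2pi.
Qed.

Lemma measurable_kac_rot i j : measurable_fun setT
  (fun p : measurableTypeR R * Rn R n => kac_rot i j p.1 p.2).
Proof.
have mc k : measurable_fun setT
    (fun p : measurableTypeR R * Rn R n => (p.2 : 'rV[R]_n) ord0 k).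
  by apply: measurableT_comp (measurable_coord k) _; exact: measurable_snd.
have ms : measurable_fun setT
    (fun p : measurableTypeR R * Rn R n => sin p.1).
  apply: measurableT_comp; last exact: measurable_fst.
  by apply: continuous_measurable_fun; exact: continuous_sin.
have mco : measurable_fun setT
    (fun p : measurableTypeR R * Rn R n => cos p.1).
  apply: measurableT_comp; last exact: measurable_fst.
  by apply: continuous_measurable_fun; exact: continuous_cos.
apply: measurable_fun_Rn => k; under eq_fun do rewrite mxE.
have [_|_] := eqVneq k i; first by apply: measurable_funB; exact: measurable_funM.
have [_|_] := eqVneq k j; last exact: mc.
by apply: measurable_funD; exact: measurable_funM.
Qed.

Lemma measurable_kac_rot_angle i j x :
  measurable_fun setT (fun th : R => kac_rot i j th x).
Proof.
apply: (measurableT_comp (measurable_kac_rot i j)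
  (_ : measurable_fun setT (fun th : measurableTypeR R => (th, x)))).
exact: measurable_fun_pair.
Qed.

Lemma measurable_kac_rot_point i j (th : R) : measurable_fun setT (kac_rot i j th).
Proof.
apply: (measurableT_comp (measurable_kac_rot i j)
  (_ : measurable_fun setT (fun x : Rn R n => (th : measurableTypeR R, x)))).
exact: measurable_fun_pair.
Qed.

Let angles := `[0%R, (2 * pi)%R[%classic : set (measurableTypeR R).

(** The range of angles is moved into the integrand so that Tonelli applies to the product with the
    whole line. *)
Definition step_integrand i j f (p : Rn R n * measurableTypeR R) : \bar R :=
  if p.2 \in angles then f (kac_rot i j p.2 p.1) else 0.

Lemma integral_step_integrand i j f x :
  \int[leb]_(th in angles) f (kac_rot i j th x) =
  \int[leb]_th step_integrand i j f (x, th).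
Proof. by rewrite integral_mkcond; apply: eq_integral => th _; rewrite /patch. Qed.

Lemma step_integrand_ge0 i j f p : (forall x, 0 <= f x) -> 0 <= step_integrand i j f p.
Proof. by move=> f0; rewrite /step_integrand; case: ifP. Qed.

Lemma measurable_step_integrand i j f : measurable_fun setT f ->
  measurable_fun setT (step_integrand i j f).
Proof.
move=> mf; apply: measurable_fun_ifT => //.
- have -> : (fun p : Rn R n * measurableTypeR R => p.2 \in angles) =
      (fun th => th \in angles) \o snd by [].
  apply: measurableT_comp; last exact: measurable_snd.
  apply: (measurable_fun_bool true); rewrite setTI.
  rewrite (_ : _ @^-1` _ = angles); first exact: measurable_itv.
  by apply/seteqP; split => th; [move/set_mem|move/mem_set].
- apply: (measurableT_comp mf).
  apply: (measurableT_comp (measurable_kac_rot i j) (_ : measurable_fun setT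
     (fun p : Rn R n * measurableTypeR R => (p.2, p.1)))).
  exact: measurable_swap.
Qed.

Lemma measurable_step i j f : measurable_fun setT f -> (forall x, 0 <= f x) ->
  measurable_fun setT (step i j f).
Proof.
move=> mf f0; apply: measurable_funeM.
under eq_fun do rewrite integral_step_integrand.
apply: (measurable_fun_fubini_tonelli_F (step_integrand i j f)) => [|p].
  exact: measurable_step_integrand.
exact: step_integrand_ge0.
Qed.

Lemma step_ge0 i j f x : (forall x, 0 <= f x) -> 0 <= step i j f x.
Proof. by move=> f0; apply: circle_mean_ge0. Qed.

Let mrot i j f x : measurable_fun setT f ->
  measurable_fun setT (fun th : R => f (kac_rot i j th x)).
Proof. by move=> mf; apply: (measurableT_comp mf); exact: measurable_kac_rot_angle. Qed.

Lemma le_step i j f g x : measurable_fun setT f -> measurable_fun setT g ->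
  (forall x, 0 <= f x) -> (forall x, f x <= g x) -> step i j f x <= step i j g x.
Proof. by move=> mf mg f0 fg; apply: le_circle_mean => //; exact: mrot. Qed.

Lemma stepD i j f g x : measurable_fun setT f -> measurable_fun setT g ->
  (forall x, 0 <= f x) -> (forall x, 0 <= g x) ->
  step i j (fun x => f x + g x) x = step i j f x + step i j g x.
Proof. by move=> mf mg f0 g0; rewrite /step circle_meanD //; exact: mrot. Qed.

Lemma step_cst i j (k : \bar R) x : step i j (fun=> k) x = k.
Proof. exact: circle_mean_cst. Qed.

End step.

(** * Stationarity of the uniform law under one rotation step *)

Section invariance.
Context {R : realType} {n : nat}.
Local Notation leb := (@lebesgue_measure R).
Implicit Types (i j k : 'I_n) (f : Rn R n -> \bar R).

Definition rot_mx i j (th : R) : 'M[R]_n := \matrix_(k, l)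
  (if l == i then (k == i)%:R * cos th - (k == j)%:R * sin th
   else if l == j then (k == i)%:R * sin th + (k == j)%:R * cos th
   else (k == l)%:R).

Lemma sum_delta (x : 'I_n -> R) i : \sum_k x k * (k == i)%:R = x i.
Proof.
rewrite (bigD1 i) //= eqxx mulr1 big1 ?addr0 // => k /negbTE ->.
by rewrite mulr0.
Qed.

Lemma mul_rot_mx i j th (x : 'rV[R]_n) : x *m rot_mx i j th = kac_rot i j th x.
Proof.
apply/rowP => l; rewrite !mxE.
have E (a b : R) : \sum_k x ord0 k * ((k == i)%:R * a + (k == j)%:R * b) =
    a * x ord0 i + b * x ord0 j.
  rewrite -(sum_delta (x ord0) i) -(sum_delta (x ord0) j) !mulr_sumr -big_split /=.
  by apply: eq_bigr => k _; ring.
under eq_bigr do rewrite !mxE.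
case: eqP => _.
  under eq_bigr do rewrite -mulrN.
  by rewrite E mulNr.
case: eqP => _; first exact: E.
exact: sum_delta.
Qed.

Lemma kac_rotK i j th (x : 'rV[R]_n) : i != j ->
  kac_rot i j (- th) (kac_rot i j th x) = x.
Proof.
move=> /negbTE ij; have ji : (j == i) = false by rewrite eq_sym.
apply/rowP => l; rewrite !mxE.
rewrite !eqxx /=.
rewrite ji cosN sinN.
have cs := cos2Dsin2 th.
have [->|li] := eqVneq l i.
  transitivity ((cos th ^+ 2 + sin th ^+ 2) * x ord0 i); first by ring.
  by rewrite cs mul1r.
have [->|//] := eqVneq l j.
transitivity ((cos th ^+ 2 + sin th ^+ 2) * x ord0 j); first by ring.
by rewrite cs mul1r.
Qed.

(** The transpose is the rotation by the opposite angle, so [kac_rotK] applies row by row. *)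
Lemma rot_mx_orthogonal i j th : i != j -> orthogonal_mx (rot_mx i j th).
Proof.
move=> ij; rewrite /orthogonal_mx.
have -> : (rot_mx i j th)^T = rot_mx i j (- th).
  apply/matrixP => k l; rewrite !mxE cosN sinN ![l == _]eq_sym.
  have bij := negbTE ij; have bji : (j == i) = false by rewrite eq_sym.
  have [->|ki] := eqVneq k i; have [->|li] := eqVneq l i.
  - by rewrite ?eqxx ?bij ?bji /=; ring.
  - rewrite ?eqxx ?bij ?bji /=; case: eqP => _ /=; first by ring.
    by rewrite ?(negbTE li) ?(eq_sym i) ?(negbTE li) /=; ring.
  - by rewrite ?eqxx ?bij ?bji ?(negbTE ki) /=; case: eqP => _ /=; ring.
  - rewrite (eq_sym j l); have [->|kj] := eqVneq k j; have [lj|lj] := eqVneq l j.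
    + by move=> /=; ring.
    + by move=> /=; ring.
    + by rewrite lj (negbTE kj) /=; ring.
    + by [].
apply/row_matrixP => k; rewrite row_mul rowE -[X in _ = row k X]mulmx1 row_mul.
by rewrite !mul_rot_mx kac_rotK // mulmx1 rowE mulmx1.
Qed.

Variable mu : probability (Rn R n) R.
Hypothesis hmu : is_uniform_sphere mu.
Local Open Scope ereal_scope.

Lemma integral_kac_rot i j th f : i != j -> measurable_fun setT f ->
  (forall x, 0 <= f x) -> \int[mu]_x f (kac_rot i j th x) = \int[mu]_x f x.
Proof.
move=> ij mf f0; have mk := measurable_kac_rot_point i j th.
rewrite -[LHS](@ge0_integral_pushforward _ _ _ _ _ _ mk mu setT f) //.
apply: eq_measure_integral => A mA _; rewrite /= /pushforward.
rewrite -[RHS](hmu.2 _ (rot_mx_orthogonal th ij) _ mA).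
by congr (mu _); apply/funext => x /=; rewrite mul_rot_mx.
Qed.

(** Tonelli takes the angle outside; for each fixed angle the rotation is orthogonal and preserves
    [mu]. *)
Lemma integral_step i j f : i != j -> measurable_fun setT f ->
  (forall x, 0 <= f x) -> \int[mu]_x step i j f x = \int[mu]_x f x.
Proof.
move=> ij mf f0.
have m_inner : measurable_fun setT
    (fun x => \int[leb]_(th in `[0%R, (2 * pi)%R[) f (kac_rot i j th x)).
  under eq_fun do rewrite integral_step_integrand.
  apply: (measurable_fun_fubini_tonelli_F (step_integrand i j f)) => [|p].
    exact: measurable_step_integrand.
  exact: step_integrand_ge0.
rewrite ge0_integralZl_EFin //; last 2 first.
- by move=> x _; exact: integral_ge0.
- by rewrite invr_ge0 mulr_ge0 // pi_ge0.
under eq_integral do rewrite integral_step_integrand.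
rewrite (fubini_tonelli (step_integrand i j f)); last 2 first.
- exact: measurable_step_integrand.
- by move=> p; exact: step_integrand_ge0.
rewrite -[RHS]circle_mean_cst /circle_mean [in RHS]integral_mkcond.
congr (_ * _); apply: eq_integral => th _; rewrite /patch /step_integrand /=.
case: ifP => _; first exact: integral_kac_rot.
exact: integral0.
Qed.

End invariance.

(** * The Markov operator *)

Section average.
Context {R : realType} {n : nat}.
Local Notation edge := ('I_n * 'I_n)%type.
Local Open Scope ereal_scope.

Definition edges : seq edge := [seq e : edge <- enum {: edge} | (e.1 < e.2)%N].

Lemma mem_edges e : (e \in edges) = (e.1 < e.2)%N.
Proof. by rewrite mem_filter mem_enum andbT. Qed.

Lemma edges_neq e : e \in edges -> e.1 != e.2.
Proof. by rewrite mem_edges => h; apply/eqP => E; rewrite E ltnn in h. Qed.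

Lemma sum_edges (V : nmodType) (F : edge -> V) :
  (\sum_(i < n) \sum_(j < n | (i < j)%N) F (i, j) = \sum_(e <- edges) F e)%R.
Proof.
rewrite pair_big_dep /= big_filter big_enum_cond /=.
by apply: eq_bigr => -[i j].
Qed.

Lemma size_edges : size edges = 'C(n, 2).
Proof.
have <- : (\sum_(e <- edges) 1 = size edges)%N by rewrite sum1_size.
rewrite -(@sum_edges nat (fun=> 1%N)) (exchange_big_dep xpredT) //= -bin2_sum.
rewrite big_mkord; apply: eq_bigr => j _; rewrite sum1dep_card.
have -> : [set i : 'I_n | (i < j)%N]%SET = [set widen_ord (ltnW (ltn_ord j)) i | i : 'I_j]%SET.
  apply/setP => i; rewrite inE; apply/idP/imsetP => [ij|[k _ ->]].
    by exists (Ordinal ij) => //; exact: val_inj.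
  exact: (valP k).
rewrite card_imset ?card_ord // => a b /(congr1 val) /= ab; exact: val_inj.
Qed.

Definition avg (F : edge -> \bar R) : \bar R :=
  (('C(n, 2))%:R^-1)%:E * \sum_(e <- edges) F e.

Definition avgr (F : edge -> R) : R :=
  (('C(n, 2))%:R^-1 * \sum_(e <- edges) F e)%R.

Lemma avgE (F : edge -> R) : avg (fun e => (F e)%:E) = (avgr F)%:E.
Proof. by rewrite /avg sumEFin. Qed.

Lemma avg_ge0 F : (forall e, e \in edges -> 0 <= F e) -> 0 <= avg F.
Proof.
move=> F0; apply: mule_ge0; first by rewrite lee_fin invr_ge0 ler0n.
by rewrite big_seq; apply: sume_ge0.
Qed.

Lemma le_avg F G : (forall e, e \in edges -> F e <= G e) -> avg F <= avg G.
Proof.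
move=> FG; apply: lee_wpmul2l; first by rewrite lee_fin invr_ge0 ler0n.
by rewrite big_seq [leRHS]big_seq; apply: lee_sum.
Qed.

Lemma eq_avg F G : (forall e, e \in edges -> F e = G e) -> avg F = avg G.
Proof. by move=> FG; rewrite /avg big_seq [in RHS]big_seq; congr (_ * _); exact: eq_bigr. Qed.

Lemma avgD F G : (forall e, 0 <= F e) -> (forall e, 0 <= G e) ->
  avg (fun e => F e + G e) = avg F + avg G.
Proof.
by move=> F0 G0; rewrite /avg big_split /= ge0_muleDr //; apply: sume_ge0.
Qed.

Lemma avgZ (k : R) F : (forall e, 0 <= F e) ->
  avg (fun e => k%:E * F e) = k%:E * avg F.
Proof. by move=> F0; rewrite /avg -ge0_sume_distrr // muleCA. Qed.

Lemma avgr_cst (k : R) : (2 <= n)%N -> avgr (fun=> k) = k.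
Proof.
move=> n2; rewrite /avgr big_const_seq count_predT size_edges iter_addr_0.
by rewrite -[(k *+ _)%R]mulr_natr mulrCA mulVf ?mulr1 // pnatr_eq0 -lt0n bin_gt0.
Qed.

Lemma avg_cst (k : \bar R) : (2 <= n)%N -> avg (fun=> k) = k.
Proof.
move=> n2; rewrite /avg; rewrite (eq_bigr (fun=> 1 * k)) => [|e _]; last by rewrite mul1e.
rewrite -ge0_sume_distrl // muleA.
have := avgE (fun=> 1%R); rewrite /avg avgr_cst // => ->.
by rewrite mul1e.
Qed.

Lemma measurable_avg d (T : measurableType d) (F : edge -> T -> \bar R) :
  (forall e, measurable_fun setT (F e)) ->
  measurable_fun setT (fun x => avg (F ^~ x)).
Proof. by move=> mF; apply: measurable_funeM; exact: emeasurable_sum. Qed.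

Lemma integral_avg d (T : measurableType d) (mu : {measure set T -> \bar R})
    (D : set T) (F : edge -> T -> \bar R) : measurable D ->
  (forall e, measurable_fun D (F e)) -> (forall e x, 0 <= F e x) ->
  \int[mu]_(x in D) avg (F ^~ x) = avg (fun e => \int[mu]_(x in D) F e x).
Proof.
move=> mD mF F0.
have m1 : measurable_fun D (fun x => \sum_(e <- edges) F e x).
  exact: emeasurable_sum.
have p1 x : 0 <= \sum_(e <- edges) F e x by apply: sume_ge0.
rewrite ge0_integralZl_EFin ?invr_ge0 ?ler0n //.
by rewrite ge0_integral_sum.
Qed.

Lemma circle_mean_avg (F : edge -> R -> \bar R) :
  (forall e, measurable_fun setT (F e)) -> (forall e x, 0 <= F e x) ->
  circle_mean (fun x => avg (F ^~ x)) = avg (fun e => circle_mean (F e)).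
Proof.
move=> mF F0; rewrite /circle_mean integral_avg //; last first.
  by move=> e; apply: measurable_funTS; exact: mF.
rewrite -avgZ // => e; exact: integral_ge0.
Qed.

End average.

Arguments edges n : clear implicits.

Section chain.
Context {R : realType} {n : nat}.
Local Open Scope ereal_scope.
Implicit Types (f g : Rn R n -> \bar R) (e : 'I_n * 'I_n).

(** The Markov operator acting on functions. All estimates are proved for it, and [kac_lawE]
    recovers the law of the walk from indicators. *)
Fixpoint kac (t : nat) f x : \bar R :=
  if t is t'.+1 then avg (fun e => step e.1 e.2 (kac t' f) x) else f x.

Lemma kac_lawE t x A : kac_law t x A = kac t (fun y => (\1_A y)%:E) x.
Proof.
elim: t x => [//|t IH] x; rewrite [LHS]/= [RHS]/=.
rewrite (@sum_edges n _ (fun e => ((2 * pi)^-1)%:E *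
  \int[@lebesgue_measure R]_(th in `[0%R, (2 * pi)%R[)
     kac_law t (kac_rot e.1 e.2 th x) A)).
congr (_ * _); apply: eq_bigr => e _; rewrite /step /circle_mean.
by congr (_ * _); apply: eq_integral => th _; rewrite IH.
Qed.

Lemma kac_ge0 t f : (forall x, 0 <= f x) -> forall x, 0 <= kac t f x.
Proof.
by move=> f0; elim: t => [//|t IH] x /=; apply: avg_ge0 => e _; exact: step_ge0.
Qed.

Lemma measurable_kac t f : measurable_fun setT f -> (forall x, 0 <= f x) ->
  measurable_fun setT (kac t f).
Proof.
move=> mf f0; elim: t => [//|t IH] /=; apply: measurable_avg => e.
by apply: measurable_step => //; exact: kac_ge0.
Qed.

Lemma le_kac t f g : measurable_fun setT f -> measurable_fun setT g ->
  (forall x, 0 <= f x) -> (forall x, f x <= g x) ->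
  forall x, kac t f x <= kac t g x.
Proof.
move=> mf mg f0 fg; have g0 x : 0 <= g x := le_trans (f0 x) (fg x).
elim: t => [//|t IH] x /=; apply: le_avg => e _.
by apply: le_step => //; [exact: measurable_kac|exact: measurable_kac|exact: kac_ge0].
Qed.

Lemma kac_cst t (k : R) x : (2 <= n)%N -> kac t (fun=> k%:E) x = k%:E.
Proof.
move=> n2; elim: t x => [//|t IH] x /=.
rewrite -{2}(@avgr_cst R n k n2) -avgE; apply: eq_avg => e _.
by rewrite -[RHS](@step_cst R n e.1 e.2 k%:E x); congr step; apply/funext => y.
Qed.

Lemma kac_add s t f x : kac (s + t) f x = kac s (kac t f) x.
Proof.
elim: s x => [//|s IH] x /=; apply: eq_avg => e _.
by congr step; apply/funext => y.
Qed.

Variable mu : probability (Rn R n) R.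
Hypothesis hmu : is_uniform_sphere mu.
Hypothesis n2 : (2 <= n)%N.

Lemma integral_kac t f : measurable_fun setT f -> (forall x, 0 <= f x) ->
  \int[mu]_x kac t f x = \int[mu]_x f x.
Proof.
move=> mf f0; elim: t => [//|t IH] /=; rewrite integral_avg //; last 2 first.
- by move=> e; apply: measurable_step; [exact: measurable_kac|exact: kac_ge0].
- by move=> e x; apply: step_ge0; exact: kac_ge0.
rewrite (@eq_avg _ _ _ (fun=> \int[mu]_x f x)); last first.
  move=> e /edges_neq e12; rewrite integral_step //; first exact: measurable_kac.
  exact: kac_ge0.
exact: avg_cst.
Qed.

End chain.

(** * Small balls under the uniform law *)

Section pair_sums.
Context {R : realType} {n : nat}.

Lemma sum_edges_sym (G : 'I_n -> 'I_n -> R) : (forall i j, G i j = G j i) ->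
  (\sum_(e <- edges n) G e.1 e.2) * 2 = \sum_i \sum_(j | j != i) G i j.
Proof.
move=> Gs; rewrite -(@sum_edges n _ (fun e => G e.1 e.2)) /= mulr_natr mulr2n.
rewrite {2}(exchange_big_dep xpredT) //= -big_split /=; apply: eq_bigr => i _.
rewrite [RHS](bigID (fun j : 'I_n => (i < j)%N)) /=; congr (_ + _).
  by apply: eq_bigl => j; rewrite -(inj_eq val_inj) /=; case: ltngtP.
apply: eq_big => [j|j _]; last exact: Gs.
by rewrite -(inj_eq val_inj) /= -leqNgt; case: ltngtP.
Qed.

Lemma avgr_sym (G : 'I_n -> 'I_n -> R) : (2 <= n)%N ->
  (forall i j, G i j = G j i) ->
  avgr (fun e => G e.1 e.2) =
  (n%:R * (n%:R - 1))^-1 * \sum_i \sum_(j | j != i) G i j.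
Proof.
move=> n2 Gs; rewrite -(sum_edges_sym Gs) /avgr.
have C2 : ('C(n, 2))%:R * 2 = n%:R * (n%:R - 1) :> R.
  rewrite -natrM mulnC -(mul_bin_diag n 1) bin1 natrM; congr (_ * _).
  by rewrite -subn1 natrB // ltnW.
by rewrite -C2; field; rewrite pnatr_eq0 -lt0n bin_gt0.
Qed.

Lemma avgrD (F G : 'I_n * 'I_n -> R) :
  avgr (fun e => F e + G e) = avgr F + avgr G.
Proof. by rewrite /avgr big_split mulrDr. Qed.

Lemma avgrZ (k : R) (F : 'I_n * 'I_n -> R) :
  avgr (fun e => k * F e) = k * avgr F.
Proof. by rewrite /avgr -mulr_sumr mulrCA. Qed.

Lemma avgr_sum (I : finType) (P : pred I) (F : I -> 'I_n * 'I_n -> R) :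
  avgr (fun e => \sum_(k | P k) F k e) = \sum_(k | P k) avgr (F k).
Proof. by rewrite /avgr exchange_big mulr_sumr. Qed.

Lemma eq_avgr (F G : 'I_n * 'I_n -> R) :
  (forall e, e \in edges n -> F e = G e) -> avgr F = avgr G.
Proof.
by move=> FG; rewrite /avgr big_seq [in RHS]big_seq; congr (_ * _); exact: eq_bigr.
Qed.

Lemma sum_distinct_pairs (T : {set 'I_n}) :
  \sum_i \sum_(j | j != i) ((i \in T) && (j \in T))%:R =
  #|T|%:R * (#|T|%:R - 1) :> R.
Proof.
rewrite (bigID (mem T)) /= [X in _ + X]big1 ?addr0; last first.
  by move=> i /negbTE iT; rewrite big1 // => j _; rewrite iT.
rewrite (eq_bigr (fun=> #|T|%:R - 1)) => [|i iT].
  by rewrite sumr_const -[LHS]mulr_natl.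
rewrite iT /= -natr_sum.
have -> : (\sum_(j | j != i) (j \in T) = #|T :\ i|)%N.
  rewrite -sum1_card big_mkcond [RHS]big_mkcond.
  by apply: eq_bigr => j _; rewrite !inE; case: (j != i); case: (j \in T).
by rewrite [in RHS](cardsD1 i T) iT natrD addrC addKr.
Qed.

Lemma avgr_inside (T : {set 'I_n}) : (2 <= n)%N ->
  avgr (fun e => ((e.1 \in T) && (e.2 \in T))%:R) =
  #|T|%:R * (#|T|%:R - 1) / (n%:R * (n%:R - 1)) :> R.
Proof.
move=> n2; rewrite (avgr_sym (G := fun i j => ((i \in T) && (j \in T))%:R)) //.
  by rewrite sum_distinct_pairs mulrC.
by move=> i j; rewrite andbC.
Qed.

End pair_sums.

Section small_ball.
Context {R : realType} {n : nat}.
Local Open Scope ereal_scope.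

Lemma pair_norm_polar (i j : 'I_n) (x : Rn R n) (phi : R) : i != j ->
  pair_norm i j (polar i j x phi) = pair_norm i j x.
Proof.
move=> ij; rewrite {1}/pair_norm /polar !mxE eqxx eq_sym (negbTE ij) eqxx.
by rewrite !exprMn -mulrDr cos2Dsin2 mulr1 sqrtr_sqr ger0_norm // pair_norm_ge0.
Qed.

Lemma measurable_sqr_pair_norm (i j : 'I_n) : measurable_fun setT
  (fun x : Rn R n => ((x : 'rV[R]_n) ord0 i ^+ 2 + (x : 'rV[R]_n) ord0 j ^+ 2)%R).
Proof.
by apply: measurable_funD; apply: measurable_funX; exact: measurable_coord.
Qed.

Variable mu : probability (Rn R n) R.
Hypothesis hmu : is_uniform_sphere mu.
Hypothesis n2 : (2 <= n)%N.

Lemma measurable_sphere : measurable (sphere R n).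
Proof.
have -> : sphere R n = (fun x : Rn R n => \sum_i ((x : 'rV[R]_n) ord0 i) ^+ 2)%R @^-1` [set 1%R].
  by [].
rewrite -[_ @^-1` _]setTI.
have : measurable_fun setT (fun x : Rn R n => \sum_i ((x : 'rV[R]_n) ord0 i) ^+ 2)%R.
  by apply: measurable_sum => i; apply: measurable_funX; exact: measurable_coord.
by apply => //; exact: measurable_set1.
Qed.

Lemma mu_sphereI A : measurable A -> mu (A `&` sphere R n) = mu A.
Proof.
move=> mA; have mS := measurable_sphere.
rewrite -[in RHS](setDUK (@subIsetl _ A (sphere R n))) measureU //.
- rewrite [X in _ + X](_ : _ = 0) ?adde0 //.
  apply/eqP; rewrite eq_le measure_ge0 andbT.
  apply: (@le_trans _ _ (mu (~` sphere R n))).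
    apply: le_measure; rewrite ?inE; [|exact: measurableC|].
      by apply: measurableD => //; exact: measurableI.
    by move=> x [Ax AS] Sx; apply: AS.
  by rewrite probability_setC // hmu.1 subee.
- exact: measurableI.
- by apply: measurableD => //; exact: measurableI.
- by rewrite setDIK.
Qed.

Definition slab (k : 'I_n) (c t : R) : set (Rn R n) :=
  [set y | (y : 'rV[R]_n) ord0 k \in `[c - t, c + t]%R].

Lemma measurable_slab k c t : measurable (slab k c t).
Proof.
rewrite (_ : slab k c t = (fun y : Rn R n => (y : 'rV[R]_n) ord0 k) @^-1` `[(c - t)%R, (c + t)%R]%classic) //.
by rewrite -[_ @^-1` _]setTI; apply: measurable_coord => //; exact: measurable_itv.
Qed.

(* The big pairs containing [k] cover the sphere, and a rotation in such a pair
   spreads coordinate [k] at scale at least n^(-1/2). *)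
Let big_pair (i j : 'I_n) : set (Rn R n) :=
  [set y | n%:R^-1 <= ((y : 'rV[R]_n) ord0 i ^+ 2 + (y : 'rV[R]_n) ord0 j ^+ 2)]%R.

Let measurable_big_pair i j : measurable (big_pair i j).
Proof.
rewrite (_ : big_pair i j = (fun x : Rn R n => ((x : 'rV[R]_n) ord0 i ^+ 2 +
   (x : 'rV[R]_n) ord0 j ^+ 2)%R) @^-1` `[(n%:R^-1)%R, +oo[%classic).
  by rewrite -[_ @^-1` _]setTI; apply: measurable_sqr_pair_norm => //; exact: measurable_itv.
by apply/seteqP; split => x /=; rewrite in_itv /= andbT.
Qed.

Let n0 : (0 < n%:R :> R)%R.
Proof. by rewrite ltr0n ltnW. Qed.

(** Stationarity replaces the indicator by its mean over rotations in the plane (k, j). These keep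
    the pair norm, which is at least n^(-1/2), and make coordinate [k] equal to this norm times the
    cosine of a uniform angle. *)
Let slab_big_pair k j c t : j != k -> (0 <= t)%R ->
  mu (slab k c t `&` big_pair k j) <= (2 * Num.sqrt (t * Num.sqrt n%:R))%:E.
Proof.
move=> jk t0; set A := _ `&` _.
have mA : measurable A by apply: measurableI => //; exact: measurable_slab.
have kj : k != j by rewrite eq_sym.
have mf : measurable_fun setT (fun x => (\1_A x)%:E : \bar R).
  by apply/measurable_EFinP; exact: measurable_indic.
rewrite -[A]setIT -integral_indic // -(integral_step hmu kj) //.
apply: (@le_trans _ _ (\int[mu]_x cst (2 * Num.sqrt (t * Num.sqrt n%:R))%:E x)); last first.
  by rewrite integral_cst //= probability_setT mule1.
have C0 : (0 <= 2 * Num.sqrt (t * Num.sqrt n%:R) :> R)%R by rewrite mulr_ge0 ?sqrtr_ge0.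
apply: ge0_le_integral => //.
- by move=> x _; apply: step_ge0.
- exact: measurable_step.
move=> x _ /=; rewrite stepE //.
have [Bx|Bx] := pselect (big_pair k j x); last first.
  rewrite (_ : (fun _ => _) = fun=> 0%:E).
    by rewrite circle_mean_cst lee_fin.
  apply/funext => phi; rewrite indicE memNset // => -[_] /=.
  by move: Bx; rewrite /big_pair /= -!sqr_pair_norm pair_norm_polar // => H /H.
have r0 : (Num.sqrt n%:R^-1 <= pair_norm k j x)%R by exact: ler_wsqrtr.
have sn0 : (0 < Num.sqrt n%:R^-1 :> R)%R by rewrite sqrtr_gt0 invr_gt0.
have rx0 := lt_le_trans sn0 r0.
apply: (@le_trans _ _ (2 * Num.sqrt (t / pair_norm k j x))%:E); last first.
  rewrite lee_fin ler_pM2l // ler_wsqrtr // ler_wpM2l //.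
  by rewrite -[leRHS]invrK -sqrtrV ?(ltW n0) // lef_pV2 ?posrE.
apply: le_trans (circle_mean_small_ball_cos c rx0 t0).
apply: le_circle_mean => //.
- by apply: (measurableT_comp mf); exact: measurable_polar.
- exact: measurable_indic_cosM.
move=> phi; rewrite lee_fin !indicE; case: (boolP (_ \in A)) => // /set_mem[].
rewrite /slab /polar /= mxE eqxx => h _.
by rewrite mem_set.
Qed.

(** A union bound over the partners j of [k]. A polynomial loss in n is harmless later, and the
    value 0 at [t = 0] makes the hyperplanes of a fixed coordinate null. *)
Lemma mu_slab_le k c t : (0 <= t)%R ->
  mu (slab k c t) <= (n%:R * (2 * Num.sqrt (t * Num.sqrt n%:R)))%:E.
Proof.
move=> t0; have mS := measurable_slab k c t.
rewrite -mu_sphereI // -[_ `&` _]setIT -integral_indic //; last first.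
  by apply: measurableI => //; exact: measurable_sphere.
have mB j : measurable (slab k c t `&` big_pair k j) by exact: measurableI.
apply: (@le_trans _ _ (\int[mu]_x \sum_(j <- enum 'I_n | j != k)
    (\1_(slab k c t `&` big_pair k j) x)%:E)).
  apply: ge0_le_integral => //.
  - apply/measurable_EFinP; apply: measurable_indic.
    by apply: measurableI => //; exact: measurable_sphere.
  - by under eq_fun do rewrite -big_filter; apply: emeasurable_sum => j;
      apply/measurable_EFinP; exact: measurable_indic.
  move=> x _; rewrite {1}indicE; case: (boolP (_ \in _)) => [|_]; last first.
    by apply: sume_ge0 => j _; rewrite lee_fin.
  move=> /set_mem[Sx sx].
  (* On the sphere some square is at least 1/n; if its index is [k] itself, any other index
     completes the pair. *)
  have [j [jk hj]] : exists j, j != k /\ big_pair k j x.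
    have [j hj] : exists j, (n%:R^-1 <= (x : 'rV[R]_n) ord0 j ^+ 2)%R.
      apply: contrapT => H; have : (\sum_(i < n) ((x : 'rV[R]_n) ord0 i) ^+ 2 < \sum_(i < n) n%:R^-1)%R.
        apply: ltr_sum; first by apply/hasP; exists (Ordinal n2).
        by move=> i _; rewrite ltNge; apply/negP => hi; apply: H; exists i.
      by rewrite sx sumr_const card_ord -[(_ *+ _)%R]mulr_natr mulVf ?gt_eqF // ltxx.
    have [jk|jk] := eqVneq j k; last first.
      by exists j; split => //; rewrite /big_pair /= (le_trans hj) // lerDr sqr_ge0.
    have [i ik] : exists i : 'I_n, i != k.
      have [kE|kE] := eqVneq (Ordinal n2) k; last by exists (Ordinal n2).
      by exists (Ordinal (ltnW n2)); rewrite -kE.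
    by exists i; split => //; rewrite /big_pair /= -jk (le_trans hj) // lerDl sqr_ge0.
  rewrite big_enum_cond /= (bigD1 j) //= indicE mem_set //=.
  rewrite -[leLHS]adde0; apply: leeD => //; apply: sume_ge0 => i _.
  by rewrite lee_fin.
under eq_integral do rewrite -big_filter.
rewrite ge0_integral_sum //; last first.
  by move=> j; apply/measurable_EFinP; exact: measurable_indic.
rewrite big_filter.
apply: (@le_trans _ _ (\sum_(j <- enum 'I_n | j != k) (2 * Num.sqrt (t * Num.sqrt n%:R))%:E)).
  by apply: lee_sum => j jk; rewrite integral_indic // setIT; exact: slab_big_pair.
rewrite sumEFin lee_fin.
have C0 : (0 <= 2 * Num.sqrt (t * Num.sqrt n%:R) :> R)%R by rewrite mulr_ge0 ?sqrtr_ge0.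
apply: (@le_trans _ _ (\sum_(j <- enum 'I_n) (2 * Num.sqrt (t * Num.sqrt n%:R)))%R).
  by rewrite big_mkcond; apply: ler_sum => j _; case: ifP.
by rewrite big_enum /= sumr_const card_ord -[leLHS]mulr_natl.
Qed.

End small_ball.

(** * Untouched coordinates *)

Section lower_bound.
Context {R : realType} {n : nat}.
Hypothesis n2 : (2 <= n)%N.
Local Open Scope ereal_scope.
Implicit Types (x z : Rn R n) (S : {set 'I_n}).

Lemma circle_mean_ge (k : R) (F : R -> \bar R) : measurable_fun setT F ->
  (forall th, 0 <= F th) -> (forall th, k%:E <= F th) -> k%:E <= circle_mean F.
Proof.
move=> mF F0 kF; have [k0|k0] := leP 0%R k.
  by rewrite -[leLHS]circle_mean_cst; apply: le_circle_mean => // th; rewrite lee_fin.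
by apply: le_trans (circle_mean_ge0 F0); rewrite lee_fin ltW.
Qed.

Definition agrees_somewhere z : set (Rn R n) :=
  [set y | exists k, (y : 'rV[R]_n) ord0 k = (z : 'rV[R]_n) ord0 k].

Lemma agrees_somewhereE z : agrees_somewhere z =
  \bigcup_(k in [set: 'I_n]) slab k ((z : 'rV[R]_n) ord0 k) 0.
Proof.
apply/seteqP; split => [y [k yk]|y [k _]].
  by exists k => //; rewrite /slab /= in_itv /= yk subr0 addr0 lexx.
by rewrite /slab /= in_itv /= subr0 addr0 -eq_le => /eqP yk; exists k.
Qed.

Lemma measurable_agrees_somewhere z : measurable (agrees_somewhere z).
Proof.
rewrite agrees_somewhereE; apply: countable_bigcupT_measurable => // k.
exact: measurable_slab.
Qed.

Lemma mu_agrees_somewhere (mu : probability (Rn R n) R) z :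
  is_uniform_sphere mu -> mu (agrees_somewhere z) = 0.
Proof.
move=> hmu; rewrite agrees_somewhereE.
apply/eqP; rewrite eq_le measure_ge0 andbT.
have slab0 k : mu (slab k ((z : 'rV[R]_n) ord0 k) 0) = 0.
  apply/eqP; rewrite eq_le measure_ge0 andbT.
  apply: le_trans (mu_slab_le hmu n2 _ _ (lexx 0%R)) _.
  by rewrite mul0r sqrtr0 !mulr0.
have -> : \bigcup_(k in [set: 'I_n]) slab k ((z : 'rV[R]_n) ord0 k) 0 =
    \big[setU/set0]_(k <- enum 'I_n) slab k ((z : 'rV[R]_n) ord0 k) 0.
  rewrite -bigcup_seq; apply: eq_bigcupl => //.
  by split => k //= _; rewrite mem_enum.
apply: (@le_trans _ _ (\sum_(k <- enum 'I_n) mu (slab k ((z : 'rV[R]_n) ord0 k) 0))).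
  elim: (enum 'I_n) => [|k s IH]; first by rewrite !big_nil measure0.
  rewrite !big_cons; apply: le_trans (leeD2l _ IH).
  apply: measureU2; first exact: measurable_slab.
  by apply: bigsetU_measurable => i _; exact: measurable_slab.
by rewrite big1 // => k _.
Qed.

(** [a] and [b] are the probabilities that a step avoids one given coordinate, respectively two
    given coordinates. *)
Let a : R := (1 - 2 / n%:R)%R.
Let b : R := ((n%:R - 2) * (n%:R - 3) / (n%:R * (n%:R - 1)))%R.

Let n0 : (n%:R != 0 :> R)%R.
Proof. by rewrite pnatr_eq0 -lt0n ltnW. Qed.

Let n1 : (n%:R - 1 != 0 :> R)%R.
Proof. by rewrite subr_eq0 pnatr_eq1 gtn_eqF. Qed.

Local Notation edge := ('I_n * 'I_n)%type.

Definition untouched (e : edge) S := (S :\: [set e.1; e.2])%SET.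

Lemma card_untouched (e : edge) S :
  (#|untouched e S|%:R = \sum_(k in S) ((e.1 \in [set~ k]) && (e.2 \in [set~ k]))%SET%:R :> R)%R.
Proof.
rewrite -natr_sum -sum1_card; congr (_%:R).
rewrite big_mkcond [RHS]big_mkcond; apply: eq_bigr => k _.
rewrite /untouched !inE (eq_sym e.1) (eq_sym e.2).
by case: (k == e.1); case: (k == e.2); case: (k \in S).
Qed.

Lemma card_untouched_pairs (e : edge) S :
  (#|untouched e S|%:R * (#|untouched e S|%:R - 1) =
   \sum_(k in S) \sum_(l in S | l != k)
     ((e.1 \in ~: [set k; l]) && (e.2 \in ~: [set k; l]))%SET%:R :> R)%R.
Proof.
rewrite -sum_distinct_pairs [RHS]big_mkcond; apply: eq_bigr => k _.
have unt l : (l \in untouched e S) = [&& l != e.1, l != e.2 & l \in S].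
  by rewrite !inE negb_or andbA.
case: ifP => kS; last first.
  by rewrite big1 // => l _; rewrite unt kS !andbF.
rewrite big_mkcond [RHS]big_mkcond; apply: eq_bigr => l _.
rewrite !unt kS !inE !negb_or (eq_sym e.1 k) (eq_sym e.1 l) (eq_sym e.2 k) (eq_sym e.2 l).
case: (l != k); rewrite ?andbF ?andbT //.
by case: (k == e.1); case: (k == e.2); case: (l == e.1); case: (l == e.2); case: (l \in S).
Qed.

Lemma avgr_untouched S : (avgr (fun e => #|untouched e S|%:R) = a * #|S|%:R)%R.
Proof.
rewrite (eq_avgr (fun e _ => card_untouched e S)) avgr_sum.
rewrite (eq_bigr (fun=> a)) ?sumr_const ?mulr_natr // => k _.
rewrite avgr_inside // cardsC1 card_ord -subn1 natrB ?(ltnW n2) // /a.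
by field; rewrite n0 n1.
Qed.

Lemma avgr_untouched_pairs S :
  (avgr (fun e => #|untouched e S|%:R * (#|untouched e S|%:R - 1)) =
   b * (#|S|%:R * (#|S|%:R - 1)))%R.
Proof.
rewrite (eq_avgr (fun e _ => card_untouched_pairs e S)) avgr_sum.
rewrite (eq_bigr (fun=> b * (#|S|%:R - 1))%R); first by rewrite sumr_const -[LHS]mulr_natl; ring.
move=> k kS; rewrite avgr_sum (eq_bigr (fun=> b)).
  rewrite sumr_const -[LHS]mulr_natr; congr (_ * _)%R.
  have -> : #|[pred l in S | l != k]| = #|S :\ k|.
    by apply: eq_card => l; rewrite !inE andbC.
  by rewrite [in RHS](cardsD1 k S) kS natrD addrC addKr.
move=> l /andP[_ lk]; rewrite avgr_inside //.
have -> : (#|~: [set k; l]|%:R = n%:R - 2 :> R)%R.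
  by rewrite cardsCs finset.setCK cards2 eq_sym lk card_ord natrB.
by rewrite /b; congr (_ / _)%R; congr (_ * _)%R; ring.
Qed.

(* The second moment bound [P(U > 0) >= 2 c E U - c^2 E U^2] for the number U
   of coordinates of S untouched after t steps, written as a recursion in t. *)
Lemma kac_agrees_somewhere_ge (c : R) t x z S :
  (forall k, k \in S -> (x : 'rV[R]_n) ord0 k = (z : 'rV[R]_n) ord0 k) ->
  ((2 * c - c ^+ 2) * (a ^+ t * #|S|%:R) -
    c ^+ 2 * (b ^+ t * (#|S|%:R * (#|S|%:R - 1))))%:E <=
  kac t (fun y => (\1_(agrees_somewhere z) y)%:E) x.
Proof.
have mi : measurable_fun setT (fun y => (\1_(agrees_somewhere z) y)%:E : \bar R).
  by apply/measurable_EFinP/measurable_indic; exact: measurable_agrees_somewhere.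
have i0 y : 0 <= (\1_(agrees_somewhere z) y)%:E :> \bar R by rewrite lee_fin.
elim: t x S => [|t IH] x S xz.
  rewrite /= !expr0 !mul1r lee_fin.
  have [->|/set0Pn[k kS]] := eqVneq S finset.set0.
    by rewrite cards0 !(mul0r, mulr0) subrr.
  rewrite indicE mem_set; last by exists k; exact: xz.
  (* At time 0 the gap between 1 and the left-hand side is exactly the square (1 - c|S|)^2. *)
  by have := sqr_ge0 (1 - c * #|S|%:R)%R => /= h; rewrite -subr_ge0;
    apply: le_trans h _; rewrite le_eqVlt; apply/orP; left; apply/eqP; ring.
rewrite /= -[X in (X - _)%R]mulr1.
pose L (m : R) := ((2 * c - c ^+ 2) * (a ^+ t * m))%R.
have -> : (((2 * c - c ^+ 2) * (a ^+ t.+1 * #|S|%:R)) * 1 -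
     c ^+ 2 * (b ^+ t.+1 * (#|S|%:R * (#|S|%:R - 1))))%R =
   avgr (fun e => ((2 * c - c ^+ 2) * (a ^+ t)) * #|untouched e S|%:R +
     (- c ^+ 2 * b ^+ t) * (#|untouched e S|%:R * (#|untouched e S|%:R - 1)))%R.
  by rewrite avgrD !avgrZ avgr_untouched avgr_untouched_pairs !exprS; ring.
(* Whatever the angle, agreement survives the pair [e] on [untouched e S], to which the induction
   hypothesis applies; the average over [e] has already produced the factors [a] and [b]. *)
rewrite -avgE; apply: le_avg => e /edges_neq e12.
apply: circle_mean_ge => [|th|th]; last first.
- apply: le_trans (IH _ (untouched e S) _).
    by rewrite lee_fin le_eqVlt; apply/orP; left; apply/eqP; ring.
  move=> k; rewrite !inE negb_or => /andP[/andP[/negbTE k1 /negbTE k2] kS].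
  by rewrite mxE k1 k2 xz.
- exact: kac_ge0.
- apply: (measurableT_comp (measurable_kac t mi i0)).
  exact: measurable_kac_rot_angle.
Qed.

(** The choice is c = 1/E U, with E U = n a^t for the number U of untouched coordinates. Since b <=
    a^2, E U(U - 1) <= (E U)^2, and the second moment bound is at least 2 - 1/E U - 1. *)
Lemma kac_law_agrees_ge t x : (3 <= n)%N ->
  (1 - (n%:R * a ^+ t)^-1)%:E <= kac_law t x (agrees_somewhere x).
Proof.
move=> n3; rewrite kac_lawE.
have nn : (3 <= n%:R :> R)%R by rewrite ler_nat.
have a0 : (0 < a)%R by rewrite subr_gt0 ltr_pdivrMr; lra.
have at0 : (0 < a ^+ t)%R by rewrite exprn_gt0.
apply: le_trans (@kac_agrees_somewhere_ge (n%:R * a ^+ t)^-1%R t x x [set: _]%SET _) => //.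
rewrite cardsT card_ord lee_fin.
have b0 : (0 <= b)%R by rewrite /b divr_ge0 // mulr_ge0 //; lra.
have ba : (b <= a ^+ 2)%R.
  rewrite /b /a ler_pdivrMr; last by rewrite mulr_gt0; lra.
  have -> : (1 - 2 / n%:R = (n%:R - 2) / n%:R :> R)%R by field.
  rewrite expr_div_n mulrAC ler_pdivlMr; last by rewrite exprn_gt0; lra.
  have n20 : (0 <= n%:R - 2 :> R)%R by lra.
  have : (0 <= (n%:R - 2) * n%:R * 2 :> R)%R by rewrite !mulr_ge0 //; lra.
  set N := n%:R in n20 *; nra.
have bat : (b ^+ t <= (a ^+ t) ^+ 2)%R by rewrite -exprM mulnC exprM lerXn2r // nnegrE exprn_ge0 ?ltW.
set A := (a ^+ t)%R in at0 bat *; set N := n%:R in nn *.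
have -> : ((2 / (N * A) - (N * A)^-1 ^+ 2) * (A * N) = 2 - (N * A)^-1)%R.
  by field; rewrite !gt_eqF //; lra.
have : ((N * A)^-1 ^+ 2 * (b ^+ t * (N * (N - 1))) <= 1)%R.
  rewrite exprVn ler_pdivrMl ?mulr1; last by rewrite exprn_gt0 // mulr_gt0 //; lra.
  have NN : (0 <= N * (N - 1))%R by rewrite mulr_ge0; lra.
  apply: le_trans (ler_wpM2r NN bat) _; rewrite exprMn mulrC.
  by rewrite ler_pM2r ?exprn_gt0 // expr2 ler_pM2l; lra.
by set X := (_ ^+ 2 * _)%R; set Y := (N * A)^-1%R; lra.
Qed.

End lower_bound.

(** * Connected components of the steps to come *)

Section blocks.
Context {n : nat}.
Local Notation edge := ('I_n * 'I_n)%type.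

(* A representative of the connected component of [k] in the graph with edge
   list [es]. *)
Fixpoint block (es : seq edge) (k : 'I_n) : 'I_n :=
  if es is e :: es' then
    if block es' k == block es' e.1 then block es' e.2 else block es' k
  else k.

Definition blocks es : {set 'I_n} := [set block es k | k : 'I_n].

Lemma mem_blocks es k : block es k \in blocks es.
Proof. exact: imset_f. Qed.

Lemma blocks_cons_same e es : block es e.1 = block es e.2 ->
  block (e :: es) =1 block es.
Proof. by move=> E k /=; case: eqP => // ->. Qed.

Lemma blocks_cons_diff e es : block es e.1 != block es e.2 ->
  blocks (e :: es) = blocks es :\ block es e.1.
Proof.
move=> d; apply/setP => l; rewrite in_setD1; apply/imsetP/andP.
  move=> [k _ ->] /=; case: ifPn => [_|kn]; split => //; rewrite ?mem_blocks //.
  by rewrite eq_sym.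
move=> [ld /imsetP[k _ lk]]; exists k => //=.
by rewrite -lk (negbTE ld).
Qed.

Lemma card_blocks_cons e es : (#|blocks (e :: es)| + (block es e.1 != block es e.2))%N
  = #|blocks es|.
Proof.
have [E|d] := eqVneq (block es e.1) (block es e.2).
  by rewrite addn0; congr #|pred_of_set _|; apply: eq_imset; exact: blocks_cons_same.
by rewrite blocks_cons_diff // (cardsD1 (block es e.1) (blocks es)) mem_blocks addnC.
Qed.

(** Every block other than that of [k] contains at least one index. *)
Lemma card_other_blocks es (k : 'I_n) :
  (#|blocks es| <= (\sum_(j | j != k) (block es k != block es j)).+1)%N.
Proof.
have -> : (\sum_(j | j != k) (block es k != block es j) =
    #|[set j | block es k != block es j]%SET|)%N.
  rewrite -sum1_card big_mkcond [RHS]big_mkcond; apply: eq_bigr => j _.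
  by rewrite inE; have [->|_] := eqVneq j k; [rewrite eqxx|case: (_ == _)].
rewrite (cardsD1 (block es k) (blocks es)) mem_blocks add1n ltnS.
apply: leq_trans (leq_imset_card (block es) _); apply: subset_leq_card.
apply/fintype.subsetP => l; rewrite in_setD1 => /andP[lk /imsetP[j _ lj]].
by apply/imsetP; exists j => //; rewrite inE eq_sym -lj.
Qed.

Lemma card_blocks_gt0 es : (0 < n)%N -> (0 < #|blocks es|)%N.
Proof.
by move=> n0; rewrite card_gt0; apply/set0Pn; exists (block es (Ordinal n0)); exact: mem_blocks.
Qed.

Definition touched (es : seq edge) (k : 'I_n) := has (fun e => (k == e.1) || (k == e.2)) es.

Lemma untouched_block es k : ~~ touched es k ->
  block es k = k /\ forall j, block es j = k -> j = k.
Proof.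
elim: es => [//|e es IH] /=; rewrite !negb_or => /andP[/andP[k1 k2]] /IH[bk bj].
have d1 : k != block es e.1 by apply: contra k1 => /eqP/esym/bj ->.
have d2 : k != block es e.2 by apply: contra k2 => /eqP/esym/bj ->.
rewrite bk (negbTE d1); split => // j; case: ifP => _; last exact: bj.
by move=> E; rewrite -E eqxx in d2.
Qed.

Lemma one_block es : #|blocks es| = 1%N -> forall j k, block es j = block es k.
Proof.
by move=> /eqP/cards1P[l bl] j k; have := mem_blocks es j; have := mem_blocks es k;
  rewrite bl !inE => /eqP -> /eqP ->.
Qed.

(** An untouched index is a block by itself. Hence, when the pairs connect everything, the sign
    condition of [compatible] is empty at the start of the second stage. *)
Lemma one_block_touched es k : (2 <= n)%N -> #|blocks es| = 1%N -> touched es k.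
Proof.
move=> n2 c1; apply/negPn/negP => /untouched_block[bk bj].
have [j jk] : exists j : 'I_n, j != k.
  have [kE|kE] := eqVneq (Ordinal n2) k; last by exists (Ordinal n2).
  by exists (Ordinal (ltnW n2)); rewrite -kE.
by move: jk; rewrite (bj j) ?eqxx // -[RHS]bk; exact: one_block.
Qed.

End blocks.

(** * Averages over lists of pairs, and the time to connect all coordinates *)

Section path_average.
Context {R : realType} {n : nat}.
Local Notation edge := ('I_n * 'I_n)%type.
Hypothesis n2 : (2 <= n)%N.

Fixpoint avgs (t : nat) (F : seq edge -> \bar R) : \bar R :=
  if t is t'.+1 then avg (fun e => avgs t' (fun es => F (e :: es))) else F [::].

Fixpoint avgsr (t : nat) (F : seq edge -> R) : R :=
  if t is t'.+1 then avgr (fun e => avgsr t' (fun es => F (e :: es))) else F [::].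

Lemma avgsE t F : avgs t (fun es => (F es)%:E) = (avgsr t F)%:E.
Proof.
elim: t F => [//|t IH] F /=; rewrite -avgE; apply: eq_avg => e _; exact: IH.
Qed.

Lemma le_avgs t F G :
  (forall es, {subset es <= edges n} -> size es = t -> (F es <= G es)%E) ->
  (avgs t F <= avgs t G)%E.
Proof.
elim: t F G => [|t IH] F G FG /=; first exact: FG.
apply: le_avg => e he; apply: IH => es hes st; apply: FG => [e'|]; last by rewrite /= st.
by rewrite inE => /orP[/eqP ->//|/hes].
Qed.

Lemma avgs_ge0 t F : (forall es, (0 <= F es)%E) -> (0 <= avgs t F)%E.
Proof. by elim: t F => [|t IH] F F0 //=; apply: avg_ge0 => e _; exact: IH. Qed.

Lemma avgsD t F G : (forall es, (0 <= F es)%E) -> (forall es, (0 <= G es)%E) ->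
  avgs t (fun es => F es + G es)%E = (avgs t F + avgs t G)%E.
Proof.
elim: t F G => [//|t IH] F G F0 G0 /=.
rewrite -avgD; [|by move=> e; exact: avgs_ge0|by move=> e; exact: avgs_ge0].
by apply: eq_avg => e _; exact: IH.
Qed.

Lemma avgs_cst t (k : \bar R) : avgs t (fun=> k) = k.
Proof.
elim: t => [//|t IH] /=; rewrite -[RHS](@avg_cst R n k) //.
by apply: eq_avg.
Qed.

Lemma measurable_avgs t d (T : measurableType d) (F : seq edge -> T -> \bar R) :
  (forall es, measurable_fun setT (F es)) ->
  measurable_fun setT (fun x => avgs t (F ^~ x)).
Proof.
elim: t F => [|t IH] F mF /=; first exact: mF.
by apply: measurable_avg => e; apply: (IH (fun es => F (e :: es))).
Qed.

Lemma ler_avgsr t F G : (forall es, F es <= G es) -> avgsr t F <= avgsr t G.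
Proof.
by move=> FG; rewrite -lee_fin -!avgsE; apply: le_avgs => es _ _; rewrite lee_fin.
Qed.

Lemma avgsr_avgr t (F : edge -> seq edge -> R) :
  avgsr t (fun es => avgr (F ^~ es)) = avgr (fun e => avgsr t (F e)).
Proof.
elim: t F => [//|t IH] F /=; rewrite [LHS](eq_avgr (fun e _ => IH _)).
by rewrite /avgr -!mulr_sumr exchange_big.
Qed.

Lemma avgsrZ t (k : R) F : avgsr t (fun es => k * F es) = k * avgsr t F.
Proof.
elim: t F => [//|t IH] F /=; rewrite -avgrZ; apply: eq_avgr => e _; exact: IH.
Qed.

(** With B blocks, each index has at least B - 1 partners outside its own block, so at least n(B -
    1) of the n(n - 1) ordered pairs cross. *)
Lemma avgr_crossing es :
  (#|blocks es|%:R - 1) / n%:R <=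
  avgr (fun e : edge => (block es e.1 != block es e.2)%:R) :> R.
Proof.
have nn : 2 <= n%:R :> R by rewrite ler_nat.
rewrite (avgr_sym (G := fun i j => (block es i != block es j)%:R)) //; last first.
  by move=> i j; rewrite eq_sym.
have c1 : 0 <= #|blocks es|%:R - 1 :> R.
  by rewrite subr_ge0 ler1n card_blocks_gt0 // ltnW.
apply: (@le_trans _ _ ((n%:R * (n%:R - 1))^-1 * (n%:R * (#|blocks es|%:R - 1)))).
  rewrite invfM mulrACA mulVf ?mul1r; last by rewrite gt_eqF //; lra.
  by rewrite mulrC ler_wpM2r // lef_pV2 ?posrE; lra.
apply: ler_wpM2l; first by rewrite invr_ge0 mulr_ge0; lra.
apply: (@le_trans _ _ (\sum_(i < n) (#|blocks es|%:R - 1))).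
  by rewrite sumr_const card_ord -[leRHS]mulr_natl.
apply: ler_sum => i _; by rewrite -natr_sum lerBlDr natr1 ler_nat card_other_blocks.
Qed.

(** Each pair lowers the mean of the number of blocks minus one by a factor 1 - 1/n, through
    [avgr_crossing]. That quantity is at least 1 on a disconnected graph, so its mean also bounds
    the probability of disconnection. *)
Lemma avgsr_blocks t :
  avgsr t (fun es => #|blocks es|%:R - 1) <= n%:R * (1 - n%:R^-1) ^+ t.
Proof.
have nn : 2 <= n%:R :> R by rewrite ler_nat.
have q0 : 0 <= 1 - n%:R^-1 :> R by rewrite subr_ge0 invf_le1; lra.
elim: t => [|t IH].
  rewrite expr0 mulr1 /= lerBlDr.
  by apply: (@le_trans _ _ n%:R); [rewrite ler_nat -[leqRHS]card_ord max_card|lra].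
(* [block] reads the list from its end, so the first pair is the last to merge blocks; its average
   is moved innermost. *)
rewrite /= -avgsr_avgr.
apply: (@le_trans _ _ ((1 - n%:R^-1) * avgsr t (fun es => #|blocks es|%:R - 1))); last first.
  by rewrite exprS mulrCA ler_wpM2l.
rewrite -avgsrZ; apply: ler_avgsr => es.
have := avgr_crossing es.
have -> : avgr (fun e => #|blocks (e :: es)|%:R - 1) =
   (#|blocks es|%:R - 1) - avgr (fun e : edge => (block es e.1 != block es e.2)%:R) :> R.
  rewrite -[X in _ = X - _](@avgr_cst R n _ n2).
  rewrite -[X in _ - X]mul1r -mulNr -avgrZ -avgrD; apply: eq_avgr => e _.
  by rewrite -(card_blocks_cons e es) natrD; ring.
by rewrite mulrBl mul1r mulrC; lra.
Qed.

End path_average.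

(** * Coupling along fixed pairs *)

Section balanced.
Context {R : realType} {n : nat}.
Implicit Types (L : 'I_n -> 'I_n) (u v : 'I_n -> R) (D : R).

(** The size is measured in l1 norm on each block because both kinds of step preserve such a bound
    with the same [D], so that no loss accumulates. *)
Definition balanced L D u := forall l,
  \sum_(k | L k == l) u k = 0 /\ \sum_(k | L k == l) `|u k| <= D.

Variables (i j : 'I_n) (u v : 'I_n -> R).
Hypothesis ij : i != j.
Hypothesis uv : forall k, k != i -> k != j -> v k = u k.

Let sumD2 (P : pred 'I_n) (F : 'I_n -> R) : P i -> P j ->
  \sum_(k | P k) F k = F i + (F j + \sum_(k | [&& P k, k != i & k != j]) F k).
Proof.
move=> Pi Pj; rewrite (bigD1 i) //= (bigD1 j) /= ?Pj 1?eq_sym //.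
by congr (_ + (_ + _)); apply: eq_bigl => k; rewrite andbA.
Qed.

Lemma balanced_same L D : L i = L j -> v i + v j = u i + u j ->
  `|v i| + `|v j| <= `|u i| + `|u j| -> balanced L D u -> balanced L D v.
Proof.
move=> Lij s a B l; have [su au] := B l.
have [lE|lE] := eqVneq (L i) l.
  have Li : L i == l by apply/eqP.
  have Lj : L j == l by rewrite -Lij.
  have E (F : R -> R) : \sum_(k | [&& L k == l, k != i & k != j]) F (v k) =
      \sum_(k | [&& L k == l, k != i & k != j]) F (u k).
    by apply: eq_bigr => k /and3P[_ ki kj]; rewrite uv.
  rewrite !(sumD2 _ Li Lj) (E id) (E Num.norm).
  move: su au; rewrite !(sumD2 _ Li Lj) => su au.
  by split; [rewrite addrA s -addrA|apply: le_trans au; rewrite !addrA lerD2r].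
have E (F : R -> R) : \sum_(k | L k == l) F (v k) = \sum_(k | L k == l) F (u k).
  apply: eq_bigr => k /eqP Lk; rewrite uv //; apply/eqP => kE; subst k.
    by rewrite Lk eqxx in lE.
  by rewrite Lij Lk eqxx in lE.
by rewrite (E id) (E Num.norm).
Qed.

(* When a block of zero sum splits in two parts and [v] has zero sum on each
   part, the new entry at [i] is minus the rest of its part, which equals the
   other part up to sign: so no part has larger l1 norm than the whole. *)
Lemma balanced_split L D : L i != L j -> v i + v j = u i + u j ->
  v i + \sum_(k | (L k == L i) && (k != i)) u k = 0 ->
  balanced (fun k => if L k == L i then L j else L k) D u -> balanced L D v.
Proof.
move=> Lij s vi B l.
have Lji : (L j == L i) = false by rewrite eq_sym (negbTE Lij).
set S1 := \sum_(k | (L k == L i) && (k != i)) u k in vi.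
pose S2 := \sum_(k | (L k == L j) && (k != j)) u k.
pose A1 := \sum_(k | (L k == L i) && (k != i)) `|u k|.
pose A2 := \sum_(k | (L k == L j) && (k != j)) `|u k|.
have S1A : `|S1| <= A1 by exact: ler_norm_sum.
have S2A : `|S2| <= A2 by exact: ler_norm_sum.
have split2 (F : R -> R) :
    \sum_(k | (if L k == L i then L j else L k) == L j) F (u k) =
    F (u i) + \sum_(k | (L k == L i) && (k != i)) F (u k) +
    (F (u j) + \sum_(k | (L k == L j) && (k != j)) F (u k)).
  rewrite (bigID (fun k => L k == L i)) /=; congr (_ + _).
    rewrite (bigD1 i) /= ?eqxx //; congr (_ + _); apply: eq_bigl => k.
    by have [_|_] := eqVneq (L k) (L i); rewrite ?eqxx ?andbF.
  rewrite (bigD1 j) /= ?Lji ?eqxx //; congr (_ + _); apply: eq_bigl => k.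
  have [->|_] := eqVneq (L k) (L i); last by rewrite andbT.
  by rewrite eqxx andbF (negbTE Lij).
have [su au] := B (L j).
rewrite (split2 id) /= -/S1 -/S2 in su; rewrite (split2 Num.norm) -/A1 -/A2 in au.
have part (m : 'I_n) (F : R -> R) : (m == i) || (m == j) ->
    \sum_(k | L k == L m) F (v k) = F (v m) + \sum_(k | (L k == L m) && (k != m)) F (u k).
  move=> mij; rewrite (bigD1 m) //=; congr (_ + _); apply: eq_bigr => k /andP[/eqP Lk km].
  rewrite uv //; apply/eqP => kE; subst k.
    by case/orP: mij => /eqP mE; subst m; [rewrite eqxx in km|rewrite Lk eqxx in Lij].
  by case/orP: mij => /eqP mE; subst m; [rewrite -Lk eqxx in Lij|rewrite eqxx in km].
have [lE|li] := eqVneq (L i) l.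
  have ii : (i == i) || (i == j) by rewrite eqxx.
  rewrite -lE (part i id) // (part i Num.norm) //= -/S1 -/A1.
  split => //; apply: le_trans au.
  have -> : v i = S2 + u i + u j by lra.
  have := ler_normD (S2 + u i) (u j); have := ler_normD S2 (u i); lra.
have [lE|lj] := eqVneq (L j) l.
  have ji : (j == i) || (j == j) by rewrite eqxx orbT.
  rewrite -lE (part j id) // (part j Num.norm) //= -/S2 -/A2.
  split; first by lra.
  apply: le_trans au.
  have -> : v j = S1 + u i + u j by lra.
  have := ler_normD (S1 + u i) (u j); have := ler_normD S1 (u i); lra.
have [sl al] := B l.
have E (F : R -> R) : \sum_(k | L k == l) F (v k) =
    \sum_(k | (if L k == L i then L j else L k) == l) F (u k).
  apply: eq_big => k.
    by have [->|_] := eqVneq (L k) (L i); [rewrite (negbTE li) (negbTE lj)|].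
  move=> /eqP Lk; rewrite uv //; apply/eqP => kE; subst k.
    by rewrite Lk eqxx in li.
  by rewrite Lk eqxx in lj.
by rewrite (E id) (E Num.norm).
Qed.

End balanced.

Section path_coupling.
Context {R : realType} {n : nat}.
Local Notation edge := ('I_n * 'I_n)%type.
Local Notation coord x k := ((x : 'rV[R]_n) ord0 k).
Implicit Types (x y : Rn R n) (es : seq edge) (e : edge).
Local Open Scope ereal_scope.

(** The conditional expectation given the list of pairs: only the angles are random. *)
Fixpoint path_mean es (f : Rn R n -> \bar R) x : \bar R :=
  if es is e :: es' then step e.1 e.2 (path_mean es' f) x else f x.

Lemma path_mean_ge0 es f x : (forall x, 0 <= f x) -> 0 <= path_mean es f x.
Proof. by move=> f0; elim: es x => [//|e es IH] x /=; exact: step_ge0. Qed.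

Lemma measurable_path_mean es f : measurable_fun setT f -> (forall x, 0 <= f x) ->
  measurable_fun setT (path_mean es f).
Proof.
move=> mf f0; elim: es => [//|e es IH] /=; apply: measurable_step => // x.
exact: path_mean_ge0.
Qed.

Lemma path_mean_le1 es f x : measurable_fun setT f -> (forall x, 0 <= f x <= 1) ->
  path_mean es f x <= 1.
Proof.
move=> mf f01; have f0 z : 0 <= f z by case/andP: (f01 z).
elim: es x => [|e es IH] x /=; first by case/andP: (f01 x).
rewrite -[leRHS](@step_cst R n e.1 e.2 1 x); apply: le_step => //.
- exact: measurable_path_mean.
- by move=> z; exact: path_mean_ge0.
Qed.

Definition small_pair (delta : R) e : set (Rn R n) :=
  [set y | coord y e.1 ^+ 2 + coord y e.2 ^+ 2 < delta]%R.

Lemma measurable_small_pair delta e : measurable (small_pair delta e).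
Proof.
rewrite (_ : small_pair delta e =
   (fun y : Rn R n => (coord y e.1 ^+ 2 + coord y e.2 ^+ 2)%R) @^-1` `]-oo, delta[%classic).
  by rewrite -[_ @^-1` _]setTI; apply: measurable_sqr_pair_norm => //; exact: measurable_itv.
by apply/seteqP; split => y /=; rewrite in_itv.
Qed.

(** Accumulated failure: [kappa] pays for the distortion of the angle, and the indicator for a pair
    of [y] too small to be coupled. It follows the chain from [y] alone, so stationarity can
    evaluate it. *)
Fixpoint path_err (delta kappa : R) es y : \bar R :=
  if es is e :: es' then
    kappa%:E + (\1_(small_pair delta e) y)%:E + step e.1 e.2 (path_err delta kappa es') y
  else 0.

Lemma path_err_ge0 delta kappa es y : (0 <= kappa)%R -> 0 <= path_err delta kappa es y.
Proof.
move=> k0; elim: es y => [//|e es IH] y /=.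
by rewrite !adde_ge0 ?lee_fin //; exact: step_ge0.
Qed.

Lemma measurable_path_err delta kappa es : (0 <= kappa)%R ->
  measurable_fun setT (path_err delta kappa es).
Proof.
move=> k0; elim: es => [|e es IH] /=; first exact: measurable_cst.
apply: emeasurable_funD; last first.
  by apply: measurable_step => // y; exact: path_err_ge0.
apply: emeasurable_funD => //; apply/measurable_EFinP/measurable_indic.
exact: measurable_small_pair.
Qed.

Definition sqdiff x y (k : 'I_n) : R := (coord x k ^+ 2 - coord y k ^+ 2)%R.

(* [es] lists the steps still to come, first step first. *)
Definition compatible es (D : R) x y :=
  balanced (block es) D (sqdiff x y) /\
  forall k, ~~ touched es k -> (0 <= coord x k * coord y k)%R.

Lemma compatible_nil D x y : compatible [::] D x y -> x = y.
Proof.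
move=> [B S]; apply/rowP => k; have [+ _] := B k; rewrite big_pred1_eq.
have xy := S k isT; move=> /eqP; rewrite subr_eq0 eqf_sqr => /predU1P[//|/eqP E].
move: xy; rewrite E mulNr oppr_ge0 -expr2 => h.
have /eqP : (coord y k ^+ 2 = 0)%R by apply/eqP; rewrite eq_le h sqr_ge0.
by rewrite sqrf_eq0 => /eqP ->; rewrite oppr0.
Qed.

Section edge.
Variables (e : edge) (es : seq edge) (x y : Rn R n) (D psi phi : R).
Hypothesis e12 : e.1 != e.2.

Let x' := polar e.1 e.2 x psi.
Let y' := polar e.1 e.2 y phi.

Lemma polar1 (z : Rn R n) (th : R) :
  (coord (polar e.1 e.2 z th) e.1 = pair_norm e.1 e.2 z * cos th)%R.
Proof. by rewrite mxE eqxx. Qed.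

Lemma polar2 (z : Rn R n) (th : R) :
  (coord (polar e.1 e.2 z th) e.2 = pair_norm e.1 e.2 z * sin th)%R.
Proof. by rewrite mxE eq_sym (negbTE e12) eqxx. Qed.

Lemma polar_other (z : Rn R n) (th : R) (k : 'I_n) : k != e.1 -> k != e.2 ->
  (coord (polar e.1 e.2 z th) k = coord z k)%R.
Proof. by move=> /negbTE k1 /negbTE k2; rewrite mxE k1 k2. Qed.

Lemma sqdiff_polar_other k : k != e.1 -> k != e.2 -> sqdiff x' y' k = sqdiff x y k.
Proof. by move=> k1 k2; rewrite /sqdiff !polar_other. Qed.

Lemma sqdiff_polarD :
  (sqdiff x' y' e.1 + sqdiff x' y' e.2 = sqdiff x y e.1 + sqdiff x y e.2)%R.
Proof.
have sx := sqr_pair_norm e.1 e.2 x; have sy := sqr_pair_norm e.1 e.2 y.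
rewrite /sqdiff !polar1 !polar2 !exprMn !sin2cos2.
transitivity (pair_norm e.1 e.2 x ^+ 2 - pair_norm e.1 e.2 y ^+ 2)%R; first by ring.
by rewrite sx sy; ring.
Qed.

(** The two coordinates of [e] take their signs from the angles; any other coordinate untouched by
    [es] is untouched by [e :: es] and agreed already. *)
Lemma polar_sign : (forall k, ~~ touched (e :: es) k -> (0 <= coord x k * coord y k)%R) ->
  (0 <= cos psi * cos phi)%R -> (0 <= sin psi * sin phi)%R ->
  forall k, ~~ touched es k -> (0 <= coord x' k * coord y' k)%R.
Proof.
move=> S c s k tk; have rx := pair_norm_ge0 e.1 e.2 x; have ry := pair_norm_ge0 e.1 e.2 y.
have [->|k1] := eqVneq k e.1; first by rewrite !polar1 mulrACA; apply: mulr_ge0 => //; exact: mulr_ge0.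
have [->|k2] := eqVneq k e.2; first by rewrite !polar2 // mulrACA; apply: mulr_ge0 => //; exact: mulr_ge0.
by rewrite !polar_other //; apply: S; rewrite /= !negb_or k1 k2.
Qed.

End edge.

(** With d the sum of the two old differences of squares, the new ones are d cos^2 phi and d sin^2
    phi, of total size |d|. *)
Lemma compatible_same e es x y D phi : e.1 != e.2 -> block es e.1 = block es e.2 ->
  compatible (e :: es) D x y ->
  compatible es D (polar e.1 e.2 x phi) (polar e.1 e.2 y phi).
Proof.
move=> e12 be [B S]; split; last first.
  by apply: polar_sign => //; rewrite -expr2 sqr_ge0.
apply: (@balanced_same R n e.1 e.2 (sqdiff x y)) => //.
- by move=> k; exact: sqdiff_polar_other.
- exact: sqdiff_polarD.
- have s := sqdiff_polarD x y phi phi e12.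
  have sx := sqr_pair_norm e.1 e.2 x; have sy := sqr_pair_norm e.1 e.2 y.
  set X := polar _ _ x _ in s *; set Y := polar _ _ y _ in s *.
  have d : (pair_norm e.1 e.2 x ^+ 2 - pair_norm e.1 e.2 y ^+ 2 =
            sqdiff x y e.1 + sqdiff x y e.2)%R by rewrite sx sy /sqdiff; ring.
  have -> : (sqdiff X Y e.1 = cos phi ^+ 2 * (sqdiff x y e.1 + sqdiff x y e.2))%R.
    by rewrite -d /sqdiff !polar1 !exprMn; ring.
  have -> : (sqdiff X Y e.2 = sin phi ^+ 2 * (sqdiff x y e.1 + sqdiff x y e.2))%R.
    by rewrite -d /sqdiff !polar2 // !exprMn; ring.
  rewrite (normrM (cos phi ^+ 2)%R) (normrM (sin phi ^+ 2)%R).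
  rewrite (ger0_norm (sqr_ge0 (cos phi))) (ger0_norm (sqr_ge0 (sin phi))).
  by rewrite -mulrDl cos2Dsin2 mul1r ler_normD.
by have : balanced (block (e :: es)) D (sqdiff x y) by [];
  rewrite (_ : block (e :: es) = block es) //; apply/funext; exact: blocks_cons_same.
Qed.

(* [rest x] is the energy of the block of [e.1] that the rotation does not touch. *)
Definition rest es e x : R :=
  \sum_(k | (block es k == block es e.1) && (k != e.1)) coord x k ^+ 2.

(** The equation cancels the differences over the part of the block that keeps [e.1]; the part of
    [e.2] then cancels because the whole block does. *)
Lemma compatible_split e es x y D psi phi : e.1 != e.2 ->
  block es e.1 != block es e.2 -> compatible (e :: es) D x y ->
  (0 <= cos psi * cos phi)%R -> (0 <= sin psi * sin phi)%R ->
  (pair_norm e.1 e.2 x ^+ 2 * cos psi ^+ 2 + rest es e x =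
   pair_norm e.1 e.2 y ^+ 2 * cos phi ^+ 2 + rest es e y)%R ->
  compatible es D (polar e.1 e.2 x psi) (polar e.1 e.2 y phi).
Proof.
move=> e12 be [B S] c s E; split; last exact: polar_sign.
apply: (@balanced_split R n e.1 e.2 (sqdiff x y)) => //.
- by move=> k; exact: sqdiff_polar_other.
- exact: sqdiff_polarD.
rewrite /sqdiff !polar1 // !exprMn sumrB -/(rest es e x) -/(rest es e y).
by move: E; lra.
Qed.

(** Both terms are bounded by disjoint parts of one l1 norm, that of the merged block, whose label
    is [block es e.2]. This makes the coefficients of the angle map close to 1 and 0. *)
Lemma compatible_close e es x y D : e.1 != e.2 -> block es e.1 != block es e.2 ->
  compatible (e :: es) D x y ->
  (`|pair_norm e.1 e.2 x ^+ 2 - pair_norm e.1 e.2 y ^+ 2| +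
   `|rest es e x - rest es e y| <= D)%R.
Proof.
move=> e12 be [B S]; have [_ +] := B (block es e.2); apply: le_trans.
have d : (pair_norm e.1 e.2 x ^+ 2 - pair_norm e.1 e.2 y ^+ 2 =
            sqdiff x y e.1 + sqdiff x y e.2)%R.
  by rewrite !sqr_pair_norm /sqdiff; ring.
rewrite d (bigID (fun k => block es k == block es e.1)) /=.
rewrite (bigD1 e.1) /= ?eqxx // [X in (_ <= _ + X)%R](bigD1 e.2) /=; last first.
  by rewrite (eq_sym (block es e.2)) (negbTE be) eqxx.
have := ler_normD (sqdiff x y e.1) (sqdiff x y e.2).
have : (`|rest es e x - rest es e y| <=
   \sum_(k | ((if block es k == block es e.1 then block es e.2 else block es k) == block es e.2)
        && (block es k == block es e.1) && (k != e.1)) `|sqdiff x y k|)%R.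
  rewrite /rest -sumrB; apply: le_trans (ler_norm_sum _ _ _) _.
  rewrite le_eqVlt; apply/orP; left; apply/eqP; apply: eq_bigl => k.
  by have [_|_] := eqVneq (block es k) (block es e.1); rewrite ?eqxx ?andbF.
move=> hM hN; apply: le_trans (lerD hN hM) _.
by rewrite addrAC [leRHS]addrA lerDl sumr_ge0.
Qed.

Variables (f : Rn R n -> \bar R) (D delta s : R).
Hypothesis mf : measurable_fun setT f.
Hypothesis f01 : forall x, 0 <= f x <= 1.
Hypothesis hs : (0 < s <= 1 / 8)%R.
Hypothesis delta0 : (0 < delta)%R.
Hypothesis hD : (4 * D <= delta * s ^+ 3)%R.

(** Induction on the pairs. A small pair of [y] is paid by the indicator, the test function being at
    most 1; a pair inside one block uses equal angles; a pair joining two blocks uses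
    [circle_coupling]. *)
Lemma path_coupling es x y : {subset es <= edges n} -> compatible es D x y ->
  path_mean es f x <= path_mean es f y + path_err delta (12 * s) es y.
Proof.
have f0 z : 0 <= f z by case/andP: (f01 z).
have k0 : (0 <= 12 * s)%R by case/andP: hs => ? ?; lra.
elim: es x y => [|e es IH] x y hes C; first by rewrite (compatible_nil C) /= adde0.
have e12 : e.1 != e.2 by apply: edges_neq; apply: hes; rewrite mem_head.
have {}IH x' y' := IH x' y' (fun e' he' => hes e' (mem_behead (s := e :: es) he')).
set g := path_mean es f in IH; set er := path_err delta (12 * s) es in IH.
have mg : measurable_fun setT g by exact: measurable_path_mean.
have mer : measurable_fun setT er by exact: measurable_path_err.
have g0 z : 0 <= g z by exact: path_mean_ge0.
have er0 z : 0 <= er z by exact: path_err_ge0.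
have g1 z : g z <= 1 by exact: path_mean_le1.
(* The later errors join the test function on the side of [y], so one angle coupling transports
   both; this [h] may exceed 1. *)
pose h z := g z + er z.
have mh : measurable_fun setT h by exact: emeasurable_funD.
have h0 z : 0 <= h z by rewrite adde_ge0.
rewrite /= -/g -/er; set ind := (\1_(small_pair delta e) y : R).
have -> : step e.1 e.2 g y + ((12 * s)%:E + ind%:E + step e.1 e.2 er y) =
    step e.1 e.2 h y + (12 * s)%:E + ind%:E.
  by rewrite /h stepD // -!addeA; congr (_ + _); rewrite addeA addeC.
have gx : measurable_fun setT (fun th => g (polar e.1 e.2 x th)).
  by apply: (measurableT_comp mg); exact: measurable_polar.
have hy : measurable_fun setT (fun th => h (polar e.1 e.2 y th)).
  by apply: (measurableT_comp mh); exact: measurable_polar.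
have [small|/negP] := boolP (coord y e.1 ^+ 2 + coord y e.2 ^+ 2 < delta)%R.
  have -> : ind = 1%R by rewrite /ind indicE mem_set.
  apply: (@le_trans _ _ 1).
    rewrite -[leRHS](@step_cst R n e.1 e.2 1 x); exact: le_step.
  by rewrite leeDr // adde_ge0 ?lee_fin //; exact: step_ge0.
move=> /negP; rewrite -leNgt -sqr_pair_norm => large.
have ind0 : 0 <= ind%:E by rewrite lee_fin.
apply: (@le_trans _ _ (step e.1 e.2 h y + (12 * s)%:E)); last by rewrite leeDl.
rewrite !stepE //.
have [be|be] := eqVneq (block es e.1) (block es e.2).
  apply: (@le_trans _ _ (circle_mean (fun th => h (polar e.1 e.2 y th)))); last first.
    by rewrite leeDl // lee_fin.
  by apply: le_circle_mean => // th; apply: IH; exact: compatible_same.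
have close := compatible_close e12 be C.
set rx := (pair_norm e.1 e.2 x ^+ 2)%R in close.
set ry := (pair_norm e.1 e.2 y ^+ 2)%R in close large.
set ux := rest es e x in close; set uy := rest es e y in close.
case/andP: hs => s0 s8.
have hD' := hD; have s3 : (0 < s ^+ 3)%R by rewrite exprn_gt0.
have s31 : (s ^+ 3 <= 1 / 8)%R.
  have ss : (s * s <= 1)%R by nra.
  by rewrite exprS expr2; nra.
have D4 : (4 * D <= delta / 8)%R.
  by apply: le_trans hD _; have := ler_pM2l delta0 (s ^+ 3)%R (1 / 8)%R; lra.
have n1 := normr_ge0 (rx - ry)%R; have n2 := normr_ge0 (ux - uy)%R.
have rx0 : (delta / 2 <= rx)%R.
  by have := ler_norm (ry - rx)%R; rewrite distrC; lra.
have rxp : (0 < rx)%R by apply: lt_le_trans rx0; rewrite divr_gt0.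
(* Writing cos^2 t = (1 + cos 2t)/2 in the equation of [compatible_split] gives these coefficients.
   The bounds come from |ry - rx| + 2|uy - ux| <= 2D <= s^3 delta/2 <= s^3 rx. *)
apply: (@circle_coupling R _ _ (ry / rx) ((ry - rx + 2 * (uy - ux)) / rx) s) => //.
- have -> : (ry / rx - 1 = (ry - rx) / rx)%R by field; lra.
  rewrite normrM normfV (gtr0_norm rxp) ler_pdivrMr // distrC.
  have := ler_wpM2l (ltW s3) rx0; lra.
- rewrite normrM normfV (gtr0_norm rxp) ler_pdivrMr //.
  have := ler_wpM2l (ltW s3) rx0.
  have := ler_normD (ry - rx)%R (2 * (uy - ux))%R.
  rewrite normrM (ger0_norm (_ : 0 <= 2)%R) // (distrC ry) (distrC uy).
  lra.
- by move=> th; rewrite g0 g1.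
move=> psi phi cc ss E; apply: IH; apply: compatible_split => //.
rewrite -/rx -/ry -/ux -/uy.
have c2 (t : R) : (cos t ^+ 2 = (1 + cos (2 * t)) / 2)%R.
  by rewrite mulr_natl cos_mulr2n; field.
rewrite !c2 E; field; lra.
Qed.

End path_coupling.

(** * Contraction *)

Section energy.
Context {R : realType} {n : nat}.
Hypothesis n2 : (2 <= n)%N.
Local Notation edge := ('I_n * 'I_n)%type.
Local Notation coord x k := ((x : 'rV[R]_n) ord0 k).
Implicit Types (x y : Rn R n) (es : seq edge) (e : edge).

Lemma sum_update (i j : 'I_n) (u v : 'I_n -> R) : i != j ->
  (forall k, k != i -> k != j -> v k = u k) ->
  \sum_k v k = \sum_k u k - u i - u j + v i + v j.
Proof.
move=> ij uv; rewrite (bigD1 i) // [X in _ = X - _ - _ + _ + _](bigD1 i) //=.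
rewrite (bigD1 j) 1?eq_sym // [X in _ = _ + X - _ - _ + _ + _](bigD1 j) 1?eq_sym //=.
rewrite (eq_bigr u); last by move=> k /andP[ki kj]; exact: uv.
by set S := \sum_(_ < _ | _) _; ring.
Qed.

Lemma polar_sphere e x phi : e.1 != e.2 -> sphere R n x -> sphere R n (polar e.1 e.2 x phi).
Proof.
move=> e12 sx; rewrite /sphere /=.
rewrite (sum_update (u := fun k => coord x k ^+ 2) e12); last first.
  by move=> k k1 k2; rewrite polar_other.
have := sqr_pair_norm e.1 e.2 x.
rewrite sx polar1 polar2 // !exprMn sin2cos2 => h.
by set r := _ ^+ 2 in h *; lra.
Qed.

Definition energy x y : R := \sum_k sqdiff x y k ^+ 2.

Lemma energy_polar e x y phi : e.1 != e.2 ->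
  energy (polar e.1 e.2 x phi) (polar e.1 e.2 y phi) =
  energy x y - sqdiff x y e.1 ^+ 2 - sqdiff x y e.2 ^+ 2 +
  (cos phi ^+ 4 + sin phi ^+ 4) * (sqdiff x y e.1 + sqdiff x y e.2) ^+ 2.
Proof.
move=> e12; rewrite /energy (sum_update (u := fun k => sqdiff x y k ^+ 2) e12); last first.
  by move=> k k1 k2; rewrite sqdiff_polar_other.
have sx := sqr_pair_norm e.1 e.2 x; have sy := sqr_pair_norm e.1 e.2 y.
have d : pair_norm e.1 e.2 x ^+ 2 - pair_norm e.1 e.2 y ^+ 2 =
    sqdiff x y e.1 + sqdiff x y e.2 by rewrite sx sy /sqdiff; ring.
rewrite -d {4 5}/sqdiff !polar1 !polar2 //.
by set a := pair_norm _ _ x; set b := pair_norm _ _ y; ring.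
Qed.

Lemma energy_ge0 x y : 0 <= energy x y.
Proof. by apply: sumr_ge0 => k _; exact: sqr_ge0. Qed.

Lemma coord_sqr_le1 x k : sphere R n x -> coord x k ^+ 2 <= 1.
Proof.
move=> sx; rewrite -[leRHS]sx (bigD1 k) //= lerDl.
by apply: sumr_ge0 => j _; exact: sqr_ge0.
Qed.

Lemma energy_le2 x y : sphere R n x -> sphere R n y -> energy x y <= 2.
Proof.
move=> sx sy; apply: (@le_trans _ _ (\sum_k (coord x k ^+ 2 + coord y k ^+ 2))).
  apply: ler_sum => k _; rewrite /sqdiff.
  have := coord_sqr_le1 k sx; have := coord_sqr_le1 k sy.
  have := sqr_ge0 (coord x k); have := sqr_ge0 (coord y k).
  by set a := _ ^+ 2; set b := _ ^+ 2 => *; nra.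
by rewrite big_split /= sx sy.
Qed.

Lemma sum_sqdiff0 x y : sphere R n x -> sphere R n y -> \sum_k sqdiff x y k = 0.
Proof. by move=> sx sy; rewrite sumrB sx sy subrr. Qed.

(** 3/4 is the mean of cos^4 + sin^4. The differences d_k sum to zero, so the products of distinct
    ones sum to -S, with S the energy, and the average equals (1 - (n + 2)/(2n(n - 1))) S. *)
Lemma avgr_energy x y : sphere R n x -> sphere R n y ->
  avgr (fun e => energy x y - sqdiff x y e.1 ^+ 2 - sqdiff x y e.2 ^+ 2 +
    3 / 4 * (sqdiff x y e.1 + sqdiff x y e.2) ^+ 2) <=
  (1 - (2 * n%:R)^-1) * energy x y.
Proof.
move=> sx sy; have s0 := sum_sqdiff0 sx sy.
have nn : 2 <= n%:R :> R by rewrite ler_nat.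
set d := sqdiff x y in s0 *; set S := energy x y.
have -> : avgr (fun e => S - d e.1 ^+ 2 - d e.2 ^+ 2 + 3 / 4 * (d e.1 + d e.2) ^+ 2) =
    S + avgr (fun e => - (1 / 4) * (d e.1 ^+ 2 + d e.2 ^+ 2) + 3 / 2 * (d e.1 * d e.2)).
  rewrite -[X in _ = X + _](@avgr_cst R n S n2) -avgrD; apply: eq_avgr => e _.
  by field.
rewrite (avgr_sym (G := fun i j => - (1 / 4) * (d i ^+ 2 + d j ^+ 2) + 3 / 2 * (d i * d j))) //;
  last by move=> i j; ring.
have D1 (F : 'I_n -> R) i : \sum_(j | j != i) F j = \sum_j F j - F i.
  by rewrite [in RHS](bigD1 i) //= addrAC subrr add0r.
have -> : \sum_i \sum_(j | j != i) (- (1 / 4) * (d i ^+ 2 + d j ^+ 2) + 3 / 2 * (d i * d j)) =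
    - ((n%:R + 2) / 2) * S.
  under eq_bigr do rewrite D1 big_split /= -!mulr_sumr big_split /= s0 sumr_const card_ord.
  rewrite -/S -/(energy x y) -/S.
  rewrite (eq_bigr (fun i => (- (n%:R / 4) - 1) * d i ^+ 2 + (- (1 / 4) * S))); last first.
    by move=> i _; rewrite -[d i ^+ 2 *+ n]mulr_natr; field.
  by rewrite big_split /= -mulr_sumr -/(energy x y) -/S sumr_const card_ord -[_ *+ n]mulr_natr; field.
have S0 : 0 <= S by exact: energy_ge0.
rewrite -subr_ge0.
have -> : (1 - (2 * n%:R)^-1) * S - (S + (n%:R * (n%:R - 1))^-1 * (- ((n%:R + 2) / 2) * S)) =
    3 / (2 * n%:R * (n%:R - 1)) * S.
  by field; rewrite !gt_eqF //; lra.
by rewrite mulr_ge0 // divr_ge0 // !mulr_ge0 //; lra.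
Qed.

(** A shift by pi/4 turns 1 - 2 (cos t sin t)^2 into 1/2 + 2 (cos t sin t)^2. The two add up to the
    constant 3/2 and have the same mean. *)
Lemma circle_mean_cos4Dsin4 :
  circle_mean (fun t : R => (cos t ^+ 4 + sin t ^+ 4)%:E) = (3 / 4)%:E.
Proof.
have pi0 := pi_gt0 R.
have mg : measurable_fun setT (fun t : R => (cos t ^+ 4 + sin t ^+ 4)%:E).
  apply/measurable_EFinP; apply: measurable_funD; apply: measurable_funX;
    apply: continuous_measurable_fun; [exact: continuous_cos|exact: continuous_sin].
have g0 t : (0 <= (cos t ^+ 4 + sin t ^+ 4)%:E :> \bar R)%E.
  by rewrite lee_fin addr_ge0 // exprn_even_ge0.
set m := circle_mean _.
have m0 : (0 <= m)%E by exact: circle_mean_ge0.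
have mm : (m + m = (3 / 2)%:E)%E.
  rewrite -{2}[m](@circle_mean_shift R (pi / 4)) //; last 2 first.
  - by apply/andP; split; lra.
  - by move=> t; rewrite mulr_natl cosD2pi sinD2pi.
  rewrite /m -circle_meanD //; last first.
    by apply: (measurableT_comp mg); exact: measurable_funD.
  rewrite -[RHS]circle_mean_cst; congr circle_mean; apply/funext => t.
  rewrite -EFinD; congr EFin.
  have pi42 : pi / 4 *+ 2 = pi / 2 :> R by lra.
  have a2 : cos (pi / 4) ^+ 2 = 1 / 2 :> R.
    by have := cos_mulr2n (pi / 4 : R); rewrite pi42 cos_pihalf; lra.
  have b2 : sin (pi / 4) ^+ 2 = 1 / 2 :> R by rewrite sin2cos2 a2; lra.
  have ab : cos (pi / 4) * sin (pi / 4) = 1 / 2 :> R.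
    by have := sin_mulr2n (pi / 4 : R); rewrite pi42 sin_pihalf; lra.
  have cs := cos2Dsin2 t.
  have c2 : cos (t + pi / 4) ^+ 2 = 1 / 2 - cos t * sin t.
    rewrite cosD; transitivity (cos t ^+ 2 * cos (pi / 4) ^+ 2 +
      sin t ^+ 2 * sin (pi / 4) ^+ 2 - 2 * (cos t * sin t) * (cos (pi / 4) * sin (pi / 4))).
      by ring.
    by rewrite a2 b2 ab -mulrDl cs; lra.
  have s2 : sin (t + pi / 4) ^+ 2 = 1 / 2 + cos t * sin t.
    by rewrite sin2cos2 c2; lra.
  have p4 (a : R) : a ^+ 4 = (a ^+ 2) ^+ 2 by rewrite -exprM.
  rewrite !p4 c2 s2 sin2cos2.
  have sc : (cos t * sin t) ^+ 2 = cos t ^+ 2 * (1 - cos t ^+ 2).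
    by rewrite exprMn sin2cos2.
  rewrite [X in _ + X](_ : _ = 1 / 2 + 2 * (cos t * sin t) ^+ 2); last by field.
  by rewrite sc; field.
have : m \is a fin_num.
  rewrite ge0_fin_numE //; apply: (@le_lt_trans _ _ (m + m)%E); first by rewrite leeDl.
  by rewrite mm ltry.
move: mm; case: m m0 => // r _ /= [].
by move=> h _; congr EFin; lra.
Qed.

End energy.

Section coupling.
Context {R : realType} {n : nat}.
Hypothesis n2 : (2 <= n)%N.
Local Notation edge := ('I_n * 'I_n)%type.
Implicit Types (x y : Rn R n) (es : seq edge) (e : edge) (f : Rn R n -> \bar R).
Local Open Scope ereal_scope.

Lemma step_contract e (F b : Rn R n -> \bar R) (c : R) x y : e.1 != e.2 ->
  measurable_fun setT F -> measurable_fun setT b ->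
  (forall x, 0 <= F x) -> (forall x, 0 <= b x) -> (0 <= c)%R ->
  (forall x y, sphere R n x -> sphere R n y -> F x <= F y + b y + (c * energy x y)%:E) ->
  sphere R n x -> sphere R n y ->
  step e.1 e.2 F x <= step e.1 e.2 F y + step e.1 e.2 b y +
    (c * (energy x y - sqdiff x y e.1 ^+ 2 - sqdiff x y e.2 ^+ 2 +
      3 / 4 * (sqdiff x y e.1 + sqdiff x y e.2) ^+ 2))%:E.
Proof.
move=> e12 mF mb F0 b0 c0 H sx sy; rewrite !stepE //.
have mp (G : Rn R n -> \bar R) z : measurable_fun setT G ->
    measurable_fun setT (fun phi => G (polar e.1 e.2 z phi)).
  by move=> mG; apply: (measurableT_comp mG); exact: measurable_polar.
have mg : measurable_fun setT (fun t : R => (cos t ^+ 4 + sin t ^+ 4)%:E : \bar R).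
  apply/measurable_EFinP; apply: measurable_funD; apply: measurable_funX;
    apply: continuous_measurable_fun; [exact: continuous_cos|exact: continuous_sin].
have g0 (t : R) : 0 <= (cos t ^+ 4 + sin t ^+ 4)%:E :> \bar R.
  by rewrite lee_fin addr_ge0 // exprn_even_ge0.
set q := ((sqdiff x y e.1 + sqdiff x y e.2) ^+ 2)%R.
set p := (energy x y - sqdiff x y e.1 ^+ 2 - sqdiff x y e.2 ^+ 2)%R.
have q0 : (0 <= c * q)%R by rewrite mulr_ge0 // sqr_ge0.
(* [p] is the energy carried by the coordinates outside [e]. *)
have p0 : (0 <= c * p)%R.
  rewrite mulr_ge0 // /p /energy (bigD1 e.1) //= (bigD1 e.2) 1?eq_sym //=.
  have E3 (u v w : R) : (u + (v + w) - u - v = w)%R by ring.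
  rewrite E3.
  by apply: sumr_ge0 => k _; exact: sqr_ge0.
have mcq : measurable_fun setT (fun t : R => (c * q)%:E * (cos t ^+ 4 + sin t ^+ 4)%:E).
  exact: measurable_funeM.
apply: (@le_trans _ _ (circle_mean (fun t : R => (F (polar e.1 e.2 y t) + b (polar e.1 e.2 y t)) +
   ((c * p)%:E + (c * q)%:E * (cos t ^+ 4 + sin t ^+ 4)%:E)))).
  apply: le_circle_mean => //; first exact: mp.
    apply: emeasurable_funD; first by apply: emeasurable_funD; exact: mp.
    by apply: emeasurable_funD => //; exact: measurable_cst.
  move=> t; apply: le_trans (H _ _ (polar_sphere t e12 sx) (polar_sphere t e12 sy)) _.
  apply: leeD => //; rewrite energy_polar // -EFinM -EFinD lee_fin -/p -/q.
  by rewrite le_eqVlt; apply/orP; left; apply/eqP; ring.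
rewrite circle_meanD //; last 4 first.
- by apply: emeasurable_funD; exact: mp.
- by apply: emeasurable_funD => //; exact: measurable_cst.
- by move=> t; rewrite adde_ge0.
- by move=> t; apply: adde_ge0; [rewrite lee_fin|apply: mule_ge0; [rewrite lee_fin|exact: g0]].
rewrite circle_meanD //; [|exact: mp..].
rewrite (@circle_meanD _ (fun=> (c * p)%:E) (fun t => (c * q)%:E * (cos t ^+ 4 + sin t ^+ 4)%:E)) //;
  [|by move=> t; apply: mule_ge0; [rewrite lee_fin|exact: g0]].
rewrite circle_mean_cst circle_meanZ // circle_mean_cos4Dsin4 -EFinM -EFinD.
by apply: leeD => //; rewrite lee_fin le_eqVlt; apply/orP; left; apply/eqP; ring.
Qed.

(** Meant for [F] the second stage, [b] its error and [c * energy] the price of not starting close: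
    during the first stage [b] travels with the chain from [y] while the energy contracts. *)
Lemma kac_contract t (F b : Rn R n -> \bar R) (c : R) x y :
  measurable_fun setT F -> measurable_fun setT b ->
  (forall x, 0 <= F x) -> (forall x, 0 <= b x) -> (0 <= c)%R ->
  (forall x y, sphere R n x -> sphere R n y -> F x <= F y + b y + (c * energy x y)%:E) ->
  sphere R n x -> sphere R n y ->
  kac t F x <= kac t F y + kac t b y + ((1 - (2 * n%:R)^-1) ^+ t * c * energy x y)%:E.
Proof.
move=> mF mb F0 b0 c0 H; elim: t x y => [|t IH] x y sx sy.
  by rewrite /= expr0 mul1r; exact: H.
have q0 : (0 <= 1 - (2 * n%:R)^-1 :> R)%R.
  have nn : (2 <= n%:R :> R)%R by rewrite ler_nat.
  by rewrite subr_ge0 invf_le1; lra.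
set a := ((1 - (2 * n%:R)^-1) ^+ t * c)%R in IH.
have a0 : (0 <= a)%R by rewrite mulr_ge0 // exprn_ge0.
rewrite /=; set G := (fun e => (a * (energy x y - sqdiff x y e.1 ^+ 2 - sqdiff x y e.2 ^+ 2 +
      3 / 4 * (sqdiff x y e.1 + sqdiff x y e.2) ^+ 2))%R).
have st0 (g : Rn R n -> \bar R) z e : (forall z, 0 <= g z) -> 0 <= step e.1 e.2 (kac t g) z.
  by move=> g0; apply: step_ge0; exact: kac_ge0.
apply: (@le_trans _ _ (avg (fun e => step e.1 e.2 (kac t F) y + step e.1 e.2 (kac t b) y) + (avgr G)%:E)).
  rewrite -avgE.
  have -> : avg (fun e => step e.1 e.2 (kac t F) y + step e.1 e.2 (kac t b) y) + avg (fun e => (G e)%:E) =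
     avg (fun e => step e.1 e.2 (kac t F) y + step e.1 e.2 (kac t b) y + (G e)%:E).
    rewrite /avg -muleDr //; first by rewrite -big_split.
    by rewrite sumEFin fin_num_adde_defl.
  apply: le_avg => e /edges_neq e12; apply: step_contract => //.
  - exact: measurable_kac.
  - exact: measurable_kac.
  - exact: kac_ge0.
  - exact: kac_ge0.
rewrite avgD; [|by move=> e; exact: st0|by move=> e; exact: st0].
apply: leeD => //; rewrite lee_fin /G avgrZ.
apply: le_trans (ler_wpM2l a0 (avgr_energy n2 sx sy)) _.
by rewrite le_eqVlt; apply/orP; left; apply/eqP; rewrite /a exprS; ring.
Qed.

Lemma step_avgs i j t (F : seq edge -> Rn R n -> \bar R) x :
  (forall es, measurable_fun setT (F es)) -> (forall es x, 0 <= F es x) ->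
  step i j (fun y => avgs t (F ^~ y)) x = avgs t (fun es => step i j (F es) x).
Proof.
elim: t F => [//|t IH] F mF F0 /=.
rewrite /step circle_mean_avg; last 2 first.
- move=> e; apply: (measurableT_comp (measurable_avgs t (F := fun es => F (e :: es)) _)) => //.
  exact: measurable_kac_rot_angle.
- by move=> e th; exact: avgs_ge0.
by apply: eq_avg => e _; exact: (IH (fun es => F (e :: es))).
Qed.

(** Averages over later pairs commute with integrals over earlier angles, so all pairs can be drawn
    before any angle. *)
Lemma kac_path t f x : measurable_fun setT f -> (forall x, 0 <= f x) ->
  kac t f x = avgs t (fun es => path_mean es f x).
Proof.
move=> mf f0; elim: t x => [//|t IH] x /=; apply: eq_avg => e _.
rewrite -(step_avgs _ _ _ (F := fun es => path_mean es f)).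
- by congr step; apply/funext => y; exact: IH.
- by move=> es; exact: measurable_path_mean.
- by move=> es z; exact: path_mean_ge0.
Qed.

Section bounds.
Variables (f : Rn R n -> \bar R) (D delta s : R).
Hypothesis mf : measurable_fun setT f.
Hypothesis f01 : forall x, 0 <= f x <= 1.
Hypothesis hs : (0 < s <= 1 / 8)%R.
Hypothesis delta0 : (0 < delta)%R.
Hypothesis D0 : (0 < D)%R.
Hypothesis hD : (4 * D <= delta * s ^+ 3)%R.

Let k0 : (0 <= 12 * s)%R.
Proof. by case/andP: hs => ? ?; lra. Qed.

(** Each bad case makes one error term at least 1: several blocks do so for [#|blocks es|%:R - 1],
    and an l1 distance above [D] forces some |x_k^2 - y_k^2| > D/n, hence an energy of at least
    D^2/n^2. Otherwise [path_coupling] applies. *)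
Lemma path_compare es x y : {subset es <= edges n} ->
  sphere R n x -> sphere R n y ->
  path_mean es f x <= path_mean es f y + path_err delta (12 * s) es y +
    (#|blocks es|%:R - 1)%:E + (n%:R ^+ 2 / D ^+ 2 * energy x y)%:E.
Proof.
move=> hes sx sy; have f0 z : 0 <= f z by case/andP: (f01 z).
have n0 : (0 < n%:R :> R)%R by rewrite ltr0n ltnW.
have c0 : (0 <= n%:R ^+ 2 / D ^+ 2 :> R)%R by rewrite divr_ge0 ?exprn_ge0 ?ltW.
have E0 : (0 <= n%:R ^+ 2 / D ^+ 2 * energy x y)%R by rewrite mulr_ge0 ?energy_ge0.
have b1 := card_blocks_gt0 es (ltnW n2).
have B0 : (0 <= #|blocks es|%:R - 1 :> R)%R by rewrite subr_ge0 ler1n.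
have P0 : 0 <= path_mean es f y + path_err delta (12 * s) es y.
  by rewrite adde_ge0 ?path_mean_ge0 ?path_err_ge0.
have le1 := path_mean_le1 es x mf f01.
have [b2|] := leqP 2 #|blocks es|.
  apply: le_trans le1 _; rewrite -addeA -[leLHS]add0e; apply: leeD => //.
  rewrite -EFinD lee_fin; have : (2 <= #|blocks es|%:R :> R)%R by rewrite ler_nat.
  lra.
rewrite ltnS => b1'; have {b1'}b1 : #|blocks es| = 1%N by apply/eqP; rewrite eqn_leq b1 b1'.
rewrite b1 subrr adde0.
have [big|small] := leP (\sum_k `|sqdiff x y k|)%R D.
  apply: (@le_trans _ _ (path_mean es f y + path_err delta (12 * s) es y)); last first.
    by rewrite leeDl // lee_fin.
  apply: (@path_coupling R n f D) => //; split; last first.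
    by move=> k; rewrite one_block_touched.
  move=> l; have [Hl|Hl] := pselect (exists k, block es k = l); last first.
    have F k : (block es k == l) = false by apply/negP => /eqP h; apply: Hl; exists k.
    by rewrite !big_pred0 ?(ltW D0).
  case: Hl => k kl; have T j : (block es j == l) = true.
    by rewrite -kl; apply/eqP; exact: one_block.
  have all_k (G : 'I_n -> R) : (\sum_(j | block es j == l) G j = \sum_j G j)%R.
    exact: eq_bigl.
  by rewrite !all_k sum_sqdiff0.
apply: le_trans le1 _; rewrite -[leLHS]add0e; apply: leeD => //; rewrite lee_fin.
have [k hk] : exists k, (D / n%:R < `|sqdiff x y k|)%R.
  apply: contrapT => H; move: small; rewrite ltNge => /negP; apply.
  apply: (@le_trans _ _ (\sum_(k < n) D / n%:R)%R).
    by apply: ler_sum => k _; rewrite leNgt; apply/negP => hk; apply: H; exists k.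
  by rewrite sumr_const card_ord -[leLHS]mulr_natr divfK ?gt_eqF.
have : (D ^+ 2 / n%:R ^+ 2 <= energy x y)%R.
  apply: (@le_trans _ _ (sqdiff x y k ^+ 2)%R); last first.
    by rewrite /energy (bigD1 k) //= lerDl; apply: sumr_ge0 => j _; exact: sqr_ge0.
  have h0 : (0 <= D / n%:R)%R by rewrite divr_ge0 // ltW.
  rewrite -expr_div_n -[leRHS]real_normK ?num_real // !expr2.
  by apply: ler_pM => //; exact: ltW.
rewrite ler_pdivrMr ?exprn_gt0 // => h.
by rewrite mulrAC ler_pdivlMr ?exprn_gt0 // mul1r mulrC.
Qed.

Lemma kac_compare t x y : sphere R n x -> sphere R n y ->
  kac t f x <= kac t f y + (avgs t (fun es => path_err delta (12 * s) es y) +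
    (n%:R * (1 - n%:R^-1) ^+ t)%:E) + (n%:R ^+ 2 / D ^+ 2 * energy x y)%:E.
Proof.
move=> sx sy; have f0 z : 0 <= f z by case/andP: (f01 z).
have E0 : 0 <= (n%:R ^+ 2 / D ^+ 2 * energy x y)%:E :> \bar R.
  by rewrite lee_fin mulr_ge0 ?energy_ge0 // divr_ge0 // sqr_ge0.
have B0 es : 0 <= (#|blocks es|%:R - 1)%:E :> \bar R.
  by rewrite lee_fin subr_ge0 ler1n card_blocks_gt0 // ltnW.
have pm0 es : 0 <= path_mean es f y by exact: path_mean_ge0.
have pe0 es : 0 <= path_err delta (12 * s) es y by exact: path_err_ge0.
rewrite !kac_path //.
apply: (@le_trans _ _ (avgs t (fun es => path_mean es f y + path_err delta (12 * s) es y +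
    (#|blocks es|%:R - 1)%:E + (n%:R ^+ 2 / D ^+ 2 * energy x y)%:E))).
  by apply: le_avgs => es hes _; exact: path_compare.
rewrite avgsD // => [|es]; last by rewrite !adde_ge0.
rewrite avgsD // => [|es]; last by rewrite adde_ge0.
rewrite avgsD // avgs_cst // avgsE; apply: leeD => //.
rewrite -addeA; apply: leeD => //; apply: leeD => //.
by rewrite lee_fin; exact: avgsr_blocks.
Qed.

End bounds.

End coupling.

(** * Total variation bounds *)

Section upper_bound.
Context {R : realType} {n : nat}.
Hypothesis n2 : (2 <= n)%N.
Local Notation edge := ('I_n * 'I_n)%type.
Implicit Types (x y : Rn R n) (es : seq edge) (e : edge) (f : Rn R n -> \bar R).
Variable mu : probability (Rn R n) R.
Hypothesis hmu : is_uniform_sphere mu.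
Local Open Scope ereal_scope.

Lemma integral_avgs t (F : seq edge -> Rn R n -> \bar R) :
  (forall es, measurable_fun setT (F es)) -> (forall es x, 0 <= F es x) ->
  \int[mu]_x avgs t (F ^~ x) = avgs t (fun es => \int[mu]_x F es x).
Proof.
elim: t F => [//|t IH] F mF F0 /=; rewrite integral_avg //; last 2 first.
- by move=> e; apply: (measurable_avgs t (F := fun es => F (e :: es))).
- by move=> e x; exact: avgs_ge0.
by apply: eq_avg => e _; exact: (IH (fun es => F (e :: es))).
Qed.

Definition small_pair_bound (delta : R) : R :=
  (n%:R * (2 * Num.sqrt (Num.sqrt delta * Num.sqrt n%:R)))%R.

(** The first coordinate of a small pair already lies within sqrt(delta) of 0. *)
Lemma mu_small_pair_le delta e : mu (small_pair delta e) <= (small_pair_bound delta)%:E.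
Proof.
apply: le_trans (mu_slab_le hmu n2 e.1 0 (sqrtr_ge0 delta)).
apply: le_measure; rewrite ?inE; [exact: measurable_small_pair|exact: measurable_slab|].
move=> y /= h; rewrite /slab /= in_itv /= sub0r add0r -ler_norml.
rewrite -sqrtr_sqr ler_wsqrtr // ltW // (le_lt_trans _ h) // lerDl.
exact: sqr_ge0.
Qed.

(** Stationarity removes the earlier rotations from each term, so every step contributes the same
    bound. *)
Lemma integral_path_err_le (delta kappa : R) es : (0 <= kappa)%R ->
  {subset es <= edges n} ->
  \int[mu]_x path_err delta kappa es x <=
  ((size es)%:R * (kappa + small_pair_bound delta))%:E.
Proof.
move=> k0; elim: es => [|e es IH] hes /=; first by rewrite integral0 mul0r.
have e12 : e.1 != e.2 by apply: edges_neq; apply: hes; rewrite inE eqxx.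
have mi : measurable_fun setT (fun x => (\1_(small_pair delta e) x)%:E : \bar R).
  by apply/measurable_EFinP/measurable_indic; exact: measurable_small_pair.
have mk : measurable_fun setT (fun x : Rn R n => kappa%:E) by exact: measurable_cst.
have pe0 x : 0 <= path_err delta kappa es x by exact: path_err_ge0.
have mpe := measurable_path_err delta es k0.
rewrite ge0_integralD //; last 4 first.
- by move=> x _; rewrite adde_ge0 // lee_fin.
- exact: emeasurable_funD.
- by move=> x _; exact: step_ge0.
- exact: measurable_step.
rewrite ge0_integralD //.
rewrite (integral_step hmu) // integral_cst //= integral_indic //; last exact: measurable_small_pair.
rewrite setIT probability_setT mule1.
rewrite -nat1r mulrDl mul1r EFinD; apply: leeD.
  by rewrite EFinD leeD // mu_small_pair_le.
by apply: IH => e' he'; apply: hes; rewrite inE he' orbT.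
Qed.

Lemma kac_le_integral f (t1 t2 : nat) (D delta s : R) x :
  measurable_fun setT f -> (forall x, 0 <= f x <= 1) ->
  (0 < s <= 1 / 8)%R -> (0 < delta)%R -> (0 < D)%R -> (4 * D <= delta * s ^+ 3)%R ->
  sphere R n x ->
  kac (t1 + t2) f x <= \int[mu]_y f y +
    (t2%:R * (12 * s + small_pair_bound delta) + n%:R * (1 - n%:R^-1) ^+ t2 +
     (1 - (2 * n%:R)^-1) ^+ t1 * (n%:R ^+ 2 / D ^+ 2) * 2)%:E.
Proof.
move=> mf f01 hs d0 D0 hD sx; have f0 z : 0 <= f z by case/andP: (f01 z).
have k0 : (0 <= 12 * s)%R by case/andP: hs => ? _; lra.
have nn : (2 <= n%:R :> R)%R by rewrite ler_nat.
have q0 : (0 <= 1 - n%:R^-1 :> R)%R by rewrite subr_ge0 invf_le1; lra.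
have r0 : (0 <= 1 - (2 * n%:R)^-1 :> R)%R by rewrite subr_ge0 invf_le1; lra.
have c0 : (0 <= n%:R ^+ 2 / D ^+ 2 :> R)%R by rewrite divr_ge0 // sqr_ge0.
have w0 : (0 <= n%:R * (1 - n%:R^-1) ^+ t2 :> R)%R by rewrite mulr_ge0 // exprn_ge0.
have mpe es := measurable_path_err delta es k0.
have pe0 es z : 0 <= path_err delta (12 * s) es z by exact: path_err_ge0.
pose err y := avgs t2 (fun es => path_err delta (12 * s) es y).
have merr : measurable_fun setT err by exact: measurable_avgs.
have err0 y : 0 <= err y by exact: avgs_ge0.
pose b (y : Rn R n) : \bar R := err y + (n%:R * (1 - n%:R^-1) ^+ t2)%:E.
have mb : measurable_fun setT b by apply: emeasurable_funD => //; exact: measurable_cst.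
have b0 y : 0 <= b y by rewrite adde_ge0.
have mF := measurable_kac t2 mf f0.
have F0 := kac_ge0 t2 f0.
set gap := ((1 - (2 * n%:R)^-1) ^+ t1 * (n%:R ^+ 2 / D ^+ 2))%R.
have gap0 : (0 <= gap)%R by rewrite mulr_ge0 // exprn_ge0.
have H y : sphere R n y ->
    kac (t1 + t2) f x <= kac t1 (kac t2 f) y + kac t1 b y + (gap * 2)%:E.
  move=> sy; rewrite kac_add.
  have hc u v : sphere R n u -> sphere R n v ->
      kac t2 f u <= kac t2 f v + b v + (n%:R ^+ 2 / D ^+ 2 * energy u v)%:E.
    by move=> su sv; exact: kac_compare.
  apply: le_trans (kac_contract n2 t1 mF mb F0 b0 c0 hc sx sy) _.
  apply: leeD => //; rewrite lee_fin ler_wpM2l //; exact: energy_le2.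
have mG : measurable_fun setT (fun y => kac t1 (kac t2 f) y + kac t1 b y).
  by apply: emeasurable_funD; exact: measurable_kac.
have G0 y : 0 <= kac t1 (kac t2 f) y + kac t1 b y by rewrite adde_ge0 ?kac_ge0.
have mS := @measurable_sphere R n.
(* The comparison is available for [y] on the sphere, which has mass 1, so the constant is
   integrated there. *)
have -> : kac (t1 + t2) f x = \int[mu]_(y in sphere R n) kac (t1 + t2) f x.
  by rewrite integral_cst //= (proj1 hmu) mule1.
apply: (@le_trans _ _ (\int[mu]_y (kac t1 (kac t2 f) y + kac t1 b y + (gap * 2)%:E))).
  apply: (@le_trans _ _ (\int[mu]_(y in sphere R n) (kac t1 (kac t2 f) y + kac t1 b y + (gap * 2)%:E))).
    apply: ge0_le_integral => //.
    - by move=> y _; exact: kac_ge0.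
    - by apply: measurable_funTS; apply: emeasurable_funD => //; exact: measurable_cst.
  apply: ge0_subset_integral => //.
  - by apply: emeasurable_funD => //; exact: measurable_cst.
  - by move=> y _; rewrite adde_ge0 // lee_fin mulr_ge0.
rewrite ge0_integralD //; last by move=> y _; rewrite lee_fin mulr_ge0.
rewrite ge0_integralD //; [|by move=> y _; exact: kac_ge0|exact: measurable_kac
  |by move=> y _; exact: kac_ge0|exact: measurable_kac].
rewrite !(integral_kac hmu) //.
rewrite [X in _ + X + _]ge0_integralD //.
rewrite !integral_cst //= probability_setT !mule1 -[leLHS]addeA.
apply: leeD => //; rewrite EFinD; apply: leeD => //; rewrite EFinD; apply: leeD => //.
rewrite integral_avgs //.
rewrite -[leRHS](@avgs_cst R n n2 t2); apply: le_avgs => es hes st.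
by apply: le_trans (integral_path_err_le delta k0 hes) _; rewrite st.
Qed.

Lemma tv_dist_kac_law_le (t1 t2 : nat) (D delta s : R) x :
  (0 < s <= 1 / 8)%R -> (0 < delta)%R -> (0 < D)%R -> (4 * D <= delta * s ^+ 3)%R ->
  sphere R n x ->
  tv_dist (kac_law (t1 + t2) x) mu <=
    (t2%:R * (12 * s + small_pair_bound delta) + n%:R * (1 - n%:R^-1) ^+ t2 +
     (1 - (2 * n%:R)^-1) ^+ t1 * (n%:R ^+ 2 / D ^+ 2) * 2)%:E.
Proof.
move=> hs d0 D0 hD sx; apply: ge_ereal_sup => _ [A mA <-].
rewrite leeBlDr ?fin_num_measure //= kac_lawE addeC.
have mi : measurable_fun setT (fun y => (\1_A y)%:E : \bar R).
  exact/measurable_EFinP/measurable_indic.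
apply: le_trans (kac_le_integral t1 t2 mi _ hs d0 D0 hD sx) _.
  by move=> y; rewrite !lee_fin indicE ler0n lern1; case: (_ \in _).
by rewrite integral_indic // setIT.
Qed.

End upper_bound.

(** * Explicit rates in n and passage to the limit *)

Section convergence.
Context {R : realType}.

Lemma onem_expn_le_expR (u : R) t : u <= 1 -> (1 - u) ^+ t <= expR (- (u * t%:R)).
Proof.
move=> u1; rewrite -mulNr expRM_natr lerXn2r ?nnegrE ?expR_ge0 ?subr_ge0 //.
exact: expR_ge1Dx.
Qed.

(** Since 1/(1 - u) = 1 + u/(1 - u) <= exp(u/(1 - u)). *)
Lemma expR_le_onem_expn (u : R) t : 0 <= u < 1 ->
  expR (- (u / (1 - u) * t%:R)) <= (1 - u) ^+ t.
Proof.
move=> /andP[u0 u1]; have v0 : 0 < 1 - u by rewrite subr_gt0.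
rewrite expRN -[leRHS]invrK lef_pV2 ?posrE ?expR_gt0 ?invr_gt0 ?exprn_gt0 //.
rewrite expRM_natr -exprVn lerXn2r ?nnegrE ?expR_ge0 ?invr_ge0 ?(ltW v0) //.
apply: le_trans (expR_ge1Dx _); rewrite le_eqVlt; apply/orP; left; apply/eqP.
by field; rewrite gt_eqF.
Qed.

Lemma cvg_ln_natr : ln (n%:R : R) @[n --> \oo] --> +oo.
Proof.
apply/cvgryPge => M; have /cvgryPge/(_ (expR M)) := @cvgr_idn R.
by apply: filterS => n h; rewrite -[M]expRK ler_ln ?posrE ?expR_gt0 // (lt_le_trans _ h) ?expR_gt0.
Qed.

Lemma cvg_expRN_ln_natr (d : R) : 0 < d -> expR (- (d * ln n%:R)) @[n --> \oo] --> (0 : R).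
Proof.
move=> d0; apply: (cvg_comp (fun n : nat => d * ln (n%:R : R)) (fun x => expR (- x))) (@cvgr_expR R).
apply/cvgryPge => M; have /cvgryPge/(_ (M / d)) := cvg_ln_natr.
by apply: filterS => n; rewrite ler_pdivrMr // mulrC.
Qed.

Lemma ln_natr_ge n : (2 <= n)%N -> 1 / 2 <= ln (n%:R : R).
Proof.
move=> n2; have nn : 2 <= n%:R :> R by rewrite ler_nat.
have := @expR_ge1Dx R (- ln n%:R); rewrite expRN lnK ?posrE; last by lra.
have : n%:R^-1 <= 2^-1 :> R by rewrite lef_pV2 ?posrE; lra.
lra.
Qed.

Lemma ln_natr_le n : (1 <= n)%N -> ln (n%:R : R) <= n%:R - 1.
Proof.
move=> n1; have nn : 1 <= n%:R :> R by rewrite ler1n.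
have := @expR_ge1Dx R (ln n%:R); rewrite lnK ?posrE; lra.
Qed.

(** Shows n a^t >= n^d with d = (1 - 2C)/2. The gap 1 - 2C is 2d: one d absorbs the replacement of n
    by n - 2 in the exponential bound, which asks for n d >= 2, and the other remains as the
    exponent. *)
Lemma kac_law_agrees_ge_expR (C : R) (n t : nat) (x : Rn R n) : C < 1 / 2 -> (3 <= n)%N ->
  2 / ((1 - 2 * C) / 2) <= n%:R -> t%:R < C * n%:R * ln (n%:R : R) ->
  ((1 - expR (- ((1 - 2 * C) / 2 * ln n%:R)))%:E <= kac_law t x (agrees_somewhere x))%E.
Proof.
move=> C12 n3 hn ht; have n2 : (2 <= n)%N := ltnW n3.
have nn : 3 <= n%:R :> R by rewrite ler_nat.
apply: le_trans (kac_law_agrees_ge n2 t x n3); rewrite lee_fin.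
have L0 := ln_natr_ge n2; set L := ln _ in L0 ht *.
set d := (1 - 2 * C) / 2 in hn *; have d0 : 0 < d by rewrite /d; lra.
set N := n%:R in nn hn ht L0 *.
rewrite lerD2l lerNl opprK expRN lef_pV2 ?posrE ?expR_gt0 //; last first.
  by rewrite mulr_gt0 ?exprn_gt0 ?subr_gt0 ?ltr_pdivrMr; lra.
have u01 : 0 <= 2 / N < 1 by rewrite divr_ge0 ?ltr_pdivrMr //=; lra.
apply: (@le_trans _ _ (N * expR (- (2 / N / (1 - 2 / N) * t%:R)))); last first.
  by rewrite ler_wpM2l ?expR_le_onem_expn //; lra.
have EN : N = expR L by rewrite lnK ?posrE //; lra.
rewrite {1}EN -expRD ler_expR.
have -> : 2 / N / (1 - 2 / N) = 2 / (N - 2).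
  by field; rewrite !gt_eqF //; lra.
rewrite lerBrDr -lerBrDl mulrAC ler_pdivrMr; last by lra.
have dN : 2 <= N * d by rewrite -ler_pdivrMr.
apply: (@le_trans _ _ (2 * (C * N * L))); first by rewrite ler_wpM2l ?ltW.
have -> : (L - d * L) * (N - 2) = 2 * (C * N * L) + L * (N * d - 2 + 2 * d) by rewrite /d; field.
by rewrite lerDl mulr_ge0 //; lra.
Qed.

(* t2 = 3 n log n steps connect the coordinates, the remaining t1 >= 197 n log n - 1
   contract; delta = n^-20 and s = n^-3 make the errors of the second stage O(1/n),
   and D = n^-29 / 4 is then the largest distance that it can absorb. *)
Lemma tv_dist_kac_law_le_inv n (mu : probability (Rn R n) R) t (x : Rn R n) :
  (2 <= n)%N -> is_uniform_sphere mu -> sphere R n x ->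
  200 * n%:R * ln (n%:R : R) < t%:R ->
  (tv_dist (kac_law t x) mu <= (75 * n%:R^-1)%:E)%E.
Proof.
move=> n2 hmu sx ht; have nn : 2 <= n%:R :> R by rewrite ler_nat.
have L0 := ln_natr_ge n2; have L1 := ln_natr_le (ltnW n2); set L := ln _ in L0 L1 ht *.
have EL : expR L = n%:R :> R by rewrite lnK ?posrE //; lra.
have NL : 1 <= n%:R * L :> R by nra.
have w0 : 0 < 2 * n%:R :> R by lra.
have w1 : (2 * n%:R)^-1 <= 1 :> R by rewrite invf_le1; lra.
set t2 := (Num.truncn (3 * n%:R * L)).+1.
have t2gt : 3 * n%:R * L < t2%:R by exact: truncnS_gt.
have t2le : t2%:R <= 3 * n%:R * L + 1.
  rewrite /t2 -natr1 lerD2r.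
  by have /andP[] : (Num.truncn (3 * n%:R * L))%:R <= 3 * n%:R * L < (Num.truncn (3 * n%:R * L)).+1%:R
    by apply: truncn_itv; lra.
have t2t : (t2 <= t)%N by rewrite -(@ler_nat R); lra.
set t1 := (t - t2)%N.
have Et : t = (t1 + t2)%N by rewrite subnK.
have t1gt : 197 * n%:R * L - 1 <= t1%:R by rewrite natrB //; lra.
set u : R := n%:R^-1.
have u0 : 0 < u by rewrite invr_gt0; lra.
have u12 : u <= 1 / 2 by rewrite /u div1r lef_pV2 ?posrE; lra.
have Nu : n%:R * u = 1 by rewrite mulfV // gt_eqF //; lra.
have uX k l : (l <= k)%N -> u ^+ k <= u ^+ l.
  by move=> kl; rewrite ler_wiXn2l ?(ltW u0) //; lra.
have uE k : u ^+ k = expR (- (k%:R * L)) by rewrite expRN expRM_natl EL exprVn.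
rewrite Et; apply: le_trans (@tv_dist_kac_law_le R n n2 mu hmu t1 t2 (u ^+ 29 / 4) (u ^+ 20) (u ^+ 3) x _ _ _ _ sx) _.
- rewrite exprn_gt0 //=; apply: (@le_trans _ _ ((1 / 2) ^+ 3)); last by lra.
  by rewrite lerXn2r ?nnegrE ?(ltW u0) // divr_ge0.
- exact: exprn_gt0.
- by rewrite divr_gt0 // exprn_gt0.
- by rewrite -exprM -exprD le_eqVlt; apply/orP; left; apply/eqP; field.
rewrite lee_fin.
(* The root of delta is n^-10 and sqrt(n) <= n, so the outer root is taken of at most n^-9 <=
   n^-8. *)
have p_le : small_pair_bound (n := n) (u ^+ 20) <= 2 * u ^+ 3.
  have -> : 2 * u ^+ 3 = n%:R * (2 * u ^+ 4) :> R.
    have E (v w : R) : v * (2 * w ^+ 4) = v * w * (2 * w ^+ 3) by ring.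
    by rewrite E Nu mul1r.
  rewrite /small_pair_bound ler_wpM2l ?ler_wpM2l //.
  rewrite -[leRHS]ger0_norm ?exprn_ge0 ?(ltW u0) // -sqrtr_sqr ler_wsqrtr // -exprM.
  rewrite (_ : 20 = 10 * 2)%N // exprM sqrtr_sqr ger0_norm ?exprn_ge0 ?(ltW u0) //.
  have sN : Num.sqrt n%:R <= n%:R :> R.
    rewrite -[leRHS]ger0_norm // -sqrtr_sqr ler_wsqrtr // expr2; nra.
  apply: (@le_trans _ _ (u ^+ 10 * n%:R)); first by rewrite ler_wpM2l // exprn_ge0 // ltW.
  rewrite exprSr -mulrA [u * _]mulrC Nu mulr1; exact: uX.
have t2N : t2%:R <= 3 * n%:R ^+ 2 :> R by nra.
have term1 : t2%:R * (12 * u ^+ 3 + small_pair_bound (n := n) (u ^+ 20)) <= 42 * u.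
  apply: (@le_trans _ _ (3 * n%:R ^+ 2 * (14 * u ^+ 3))).
    apply: ler_pM => //; last by lra.
    rewrite addr_ge0 ?mulr_ge0 ?exprn_ge0 ?sqrtr_ge0 ?(ltW u0) //.
  rewrite le_eqVlt; apply/orP; left; apply/eqP.
  have -> : 3 * n%:R ^+ 2 * (14 * u ^+ 3) = 42 * (n%:R * u) ^+ 2 * u by ring.
  by rewrite Nu expr1n mulr1.
(* More than 3 n log n steps bring (1 - 1/n)^t2 below n^-3. *)
have term2 : n%:R * (1 - u) ^+ t2 <= u.
  have h : (1 - u) ^+ t2 <= u ^+ 3.
    apply: le_trans (@onem_expn_le_expR u t2 _) _; first by lra.
    rewrite uE ler_expR lerN2 -[leRHS]mulrC /u ler_pdivlMr; last by lra.
    by apply: ltW; apply: le_lt_trans t2gt; rewrite le_eqVlt; apply/orP; left; apply/eqP; ring.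
  apply: (@le_trans _ _ (n%:R * u ^+ 3)); first by rewrite ler_wpM2l.
  by rewrite exprS mulrA Nu mul1r -[leRHS]expr1; exact: uX.
(* t1 >= 196 n log n because n log n >= 1; at rate 1/(2n) this gives n^-98, against n^2/D^2 = 16
   n^60. *)
have term3 : (1 - (2 * n%:R)^-1) ^+ t1 * (n%:R ^+ 2 / (u ^+ 29 / 4) ^+ 2) * 2 <= 32 * u.
  have h : (1 - (2 * n%:R)^-1) ^+ t1 <= u ^+ 98.
    apply: le_trans (@onem_expn_le_expR _ t1 w1) _.
    rewrite uE ler_expR lerN2 -[leRHS]mulrC ler_pdivlMr //.
    apply: le_trans t1gt.
    have -> : 98%:R * L * (2 * n%:R) = 196 * (n%:R * L) by ring.
    by clear -NL; lra.
  have c0 : 0 <= n%:R ^+ 2 / (u ^+ 29 / 4) ^+ 2 by rewrite divr_ge0 // sqr_ge0.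
  apply: (@le_trans _ _ (u ^+ 98 * (n%:R ^+ 2 / (u ^+ 29 / 4) ^+ 2) * 2)).
    by rewrite ler_wpM2r // ler_wpM2r.
  have -> : u ^+ 98 * (n%:R ^+ 2 / (u ^+ 29 / 4) ^+ 2) * 2 = 32 * (n%:R * u) ^+ 2 * u ^+ 38.
    by field; rewrite gt_eqF.
  by rewrite Nu expr1n mulr1 ler_wpM2l // -[leRHS]expr1; exact: uX.
apply: le_trans (lerD (lerD term1 term2) term3) _.
by have E (v : R) : 42 * v + v + 32 * v = 75 * v; [ring|rewrite E].
Qed.

(** Guards against an empty set of starting points, over which the infimum and supremum would be
    infinite. *)
Lemma sphere_neq0 n (mu : probability (Rn R n) R) : is_uniform_sphere mu ->
  exists x, sphere R n x.
Proof.
move=> [s _]; apply: contrapT => H; move: s.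
rewrite (_ : sphere R n = set0) ?measure0; last first.
  by apply/seteqP; split => x // sx; apply: H; exists x.
by move/esym/eqP; rewrite onee_eq0.
Qed.

Lemma tv_dist_kac_law_le1 n (mu : probability (Rn R n) R) t (x : Rn R n) : (2 <= n)%N ->
  (tv_dist (kac_law t x) mu <= 1)%E.
Proof.
move=> n2; apply: ge_ereal_sup => _ [A mA <-].
apply: (@le_trans _ _ (kac_law t x A)).
  by rewrite leeBlDr ?fin_num_measure // leeDl.
rewrite kac_lawE -[leRHS](@kac_cst R n t 1 x n2); apply: le_kac.
- exact/measurable_EFinP/measurable_indic.
- exact: measurable_cst.
- by move=> y; rewrite lee_fin.
- by move=> y; rewrite lee_fin indicE lern1; case: (_ \in _).
Qed.

Lemma tv_dist_kac_law_ge0 n (mu : probability (Rn R n) R) t (x : Rn R n) :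
  (0 <= tv_dist (kac_law t x) mu)%E.
Proof.
apply: le_ereal_sup_tmp; exists (kac_law t x set0).
  by exists set0; [exact: measurable0|rewrite measure0 sube0].
by rewrite kac_lawE; apply: kac_ge0 => y; rewrite lee_fin.
Qed.

Lemma tv_dist_kac_law_ge n (mu : probability (Rn R n) R) (C : R) t (x : Rn R n) :
  is_uniform_sphere mu -> C < 1 / 2 -> (3 <= n)%N ->
  2 / ((1 - 2 * C) / 2) <= n%:R -> t%:R < C * n%:R * ln (n%:R : R) ->
  ((1 - expR (- ((1 - 2 * C) / 2 * ln n%:R)))%:E <= tv_dist (kac_law t x) mu)%E.
Proof.
move=> hmu C12 n3 hn ht; apply: le_ereal_sup_tmp.
exists (kac_law t x (agrees_somewhere x)); last exact: kac_law_agrees_ge_expR.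
exists (agrees_somewhere x); first exact: measurable_agrees_somewhere.
by rewrite mu_agrees_somewhere ?sube0 // ltnW.
Qed.

End convergence.

Theorem theorem1p1 (R : realType)
    (mu : forall n : nat, probability (Rn R n) R)
    (hmu : forall n : nat, (2 <= n)%N -> is_uniform_sphere (mu n)) :
  (forall (C1 : R) (T1 : nat -> nat),
     C1 < 1 / 2 ->
     (forall n : nat, (2 <= n)%N -> (T1 n)%:R < C1 * n%:R * ln (n%:R : R)) ->
     (fun n : nat =>
        ereal_inf [set tv_dist (kac_law (T1 n) x0) (mu n)
                  | x0 in sphere R n]) @ \oo --> 1%E)
  /\
  (forall (C2 : R) (T2 : nat -> nat),
     200 < C2 ->
     (forall n : nat, (2 <= n)%N -> C2 * n%:R * ln (n%:R : R) < (T2 n)%:R) ->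
     (fun n : nat =>
        ereal_sup [set tv_dist (kac_law (T2 n) x0) (mu n)
                  | x0 in sphere R n]) @ \oo --> 0%E).
Proof.
split => [C T C12 hT|C T C200 hT].
- set d : R := (1 - 2 * C) / 2; have d0 : 0 < d by rewrite /d; lra.
  apply: (@squeeze_cvge _ _ _ R (fun n => (1 - expR (- (d * ln n%:R)))%:E) _ (cst 1%E)).
  + have /cvgryPge/(_ (2 / d)) := @cvgr_idn R.
    apply: filterS2 (nbhs_infty_ge 3) => n n3 hn; have n2 : (2 <= n)%N := ltnW n3.
    have [x sx] := sphere_neq0 (hmu n n2); apply/andP; split; last first.
      apply: ge_ereal_inf; exists (tv_dist (kac_law (T n) x) (mu n)); first by exists x.
      exact: tv_dist_kac_law_le1.
    apply: le_ereal_inf_tmp => _ [y sy <-].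
    exact: tv_dist_kac_law_ge (hmu n n2) C12 n3 hn (hT n n2).
  + apply: cvg_EFin; first exact: nearW.
    rewrite -[X in _ --> X]subr0; apply: cvgB; first exact: cvg_cst.
    exact: cvg_expRN_ln_natr.
  + exact: cvg_cst.
- apply: (@squeeze_cvge _ _ _ R (cst 0%E) _ (fun n => (75 * n%:R^-1)%:E)).
  + near=> n; have n2 : (2 <= n)%N by near: n; exact: nbhs_infty_ge.
    have [x sx] := sphere_neq0 (hmu n n2); apply/andP; split.
      apply: le_ereal_sup_tmp; exists (tv_dist (kac_law (T n) x) (mu n)); first by exists x.
      exact: tv_dist_kac_law_ge0.
    apply: ge_ereal_sup => _ [y sy <-]; apply: tv_dist_kac_law_le_inv => //; first exact: hmu.
    apply: le_lt_trans (hT n n2); rewrite -!mulrA ler_wpM2r ?(ltW C200) //.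
    by rewrite mulr_ge0 //; have := @ln_natr_ge R n n2; lra.
  + exact: cvg_cst.
  + apply: cvg_EFin; first exact: nearW.
    rewrite -[X in _ --> X](mulr0 75); apply: cvgM; first exact: cvg_cst.
    apply/gtr0_cvgV0; last exact: cvgr_idn.
    by near=> n; rewrite ltr0n; near: n; exact: nbhs_infty_gt.
Unshelve. all: by end_near.
Qed.
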